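(* Let $d\ge 1$, let $A,B$ be finite alphabets, let $p$ be a probability vector on $A$ and $q$ a probability vector on $B$, and let $X\sim\mu=p^{\mathbb{Z}^d}$ and $Y\sim\nu=q^{\mathbb{Z}^d}$ be the corresponding i.i.d. $\mathbb{Z}^d$-processes. Assume $X$ and $Y$ have equal entropy, $h(p)=h(q)$. If there exists a finitary homomorphism $\phi:X\to Y$ whose coding radius satisfies $\mathbf{E}[R_\phi^{d/2}]<\infty$, then $\mathrm{Var}(I_p(X_0))=\mathrm{Var}(I_q(Y_0))$, i.e. $\mathrm{Var}(\log p(X_0))=\mathrm{Var}(\log q(Y_0))$.
   Context: For a finite probability vector $p$ on $A$, the entropy is $h(p)=-\sum_{a\in A}p_a\log p_a$ and the information function is $I_p(a)=\log p_a^{-1}$. A homomorphism (factor map) $\phi:X\to Y$ is a measurable map $\phi:A^{\mathbb{Z}^d}\to B^{\mathbb{Z}^d}$, defined $\mu$-a.e., that commutes with the $\mathbb{Z}^d$-shifts ($\phi(T_{u}x)=T_u\phi(x)$, where $(T_{-u}x)_v=x_{v+u}$) and satisfies $\phi_*\mu=\nu$. With $B(0,n)=[-n,n]^d\subset\mathbb{Z}^d$, the coding radius of $\phi$ is the random variable $R_\phi(x)=\min\{n\in\mathbb{N}\cup\{\infty\}: \text{for }\mu\text{-a.e. } a,\ (a_i)_{i\in B(0,n)}=(x_i)_{i\in B(0,n)}\Rightarrow \phi(a)_0=\phi(x)_0\}$. The map $\phi$ is finitary if $R_\phi<\infty$ $\mu$-a.s. *)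

(* Defs.v *)
From HB Require Import structures.
From mathcomp Require Import all_boot all_order all_algebra finmap.
From mathcomp Require Import all_classical all_reals all_analysis.

Set Implicit Arguments.
Unset Strict Implicit.
Unset Printing Implicit Defensive.
Import Order.TTheory GRing.Theory Num.Theory.
Local Open Scope classical_set_scope.
Local Open Scope ring_scope.

Definition site (d : nat) := 'rV[int]_d.

(* A finite alphabet A, pointed by some a0 : A (pointedness is only used
   to equip the configuration space with a measurable-type structure;
   any alphabet carrying a probability vector is nonempty). *)
Definition palph (A : finType) (a0 : A) : Type := A.
HB.instance Definition _ (A : finType) (a0 : A) := Finite.on (palph a0).
HB.instance Definition _ (A : finType) (a0 : A) := isPointed.Build (palph a0) a0.

Definition config (d : nat) (A : finType) (a0 : A) := site d -> palph a0.

Definition coord_events (d : nat) (A : finType) (a0 : A) : set (set (config d a0)) :=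
  [set C | exists (v : site d) (a : A), C = [set x | x v = a]].

Definition Omega (d : nat) (A : finType) (a0 : A) :=
  g_sigma_algebraType (@coord_events d A a0).

Definition prob_vec (R : realType) (A : finType) (p : A -> R) :=
  (forall a, 0 <= p a) /\ \sum_(a : A) p a = 1.

(* mu is the i.i.d. measure p^{Z^d}: the probability of every finite
   cylinder is the product of the one-site probabilities (this determines
   mu uniquely on the product sigma-algebra). *)
Definition iid_measure (R : realType) (d : nat) (A : finType) (a0 : A)
  (p : A -> R) (mu : probability (Omega d a0) R) :=
  forall (F : {fset site d}) (w : site d -> A),
    mu [set x : Omega d a0 | forall v, v \in F -> x v = w v]
    = (\prod_(v <- F) p (w v))%:E.

Definition entropy (R : realType) (A : finType) (p : A -> R) : R :=
  - \sum_(a : A) p a * ln (p a).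
Definition info (R : realType) (A : finType) (p : A -> R) (a : A) : R :=
  ln ((p a)^-1).

Definition shift (d : nat) (T : Type) (u : site d) (x : site d -> T) : site d -> T :=
  fun v => x (v + u).

Definition factor_map (R : realType) (d : nat) (A B : finType) (a0 : A) (b0 : B)
  (mu : probability (Omega d a0) R) (nu : probability (Omega d b0) R)
  (phi : Omega d a0 -> Omega d b0) :=
  [/\ measurable_fun setT phi,
      (forall u : site d, {ae mu, forall x, phi (shift u x) = shift u (phi x)}) &
      (forall S : set (Omega d b0), measurable S -> mu (phi @^-1` S) = nu S)].

Definition in_box (d : nat) (n : nat) (v : site d) : Prop :=
  forall i : 'I_d, `|v ord0 i| <= n%:Z.

Definition coding_radius (R : realType) (d : nat) (A B : finType) (a0 : A) (b0 : B)
  (mu : probability (Omega d a0) R) (phi : Omega d a0 -> Omega d b0)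
  (x : Omega d a0) : \bar R :=
  ereal_inf [set (n%:R)%:E | n in
    [set n : nat | {ae mu, forall a : Omega d a0,
        (forall v, in_box n v -> a v = x v) -> phi a 0 = phi x 0}]].

(* Main.v *)
(** Fix [M] and let [z_v] be the value of [phi(x)_v] when the box of radius [M]
    around [v] determines it, and "unknown" otherwise.  A cylinder of [x] is
    almost surely mapped into a cylinder of [phi(x)], so
    [sum I_q(z_v) <= sum I_p(x_v)] pointwise, the second sum being over a
    slightly larger box.  For a configuration [w] with period [n], letting the box
    grow kills the boundary term: the sum [F(w)] of [I_p(w_v) - I_q(z_v)] over
    one period is nonnegative for every [w].  Since the entropies agree, its mean
    is at most a constant times [n^d P(R > M)], which for suitable [M]
    proportional to [n] is [o(n^(d/2))].  Hence [F] is [o(n^(d/2))] in L^1, which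
    is below the scale of the central limit theorem.

    To compare variances, [F] is tested against bounded functions [g] of the
    coordinates in a block [W]: by independence only the sites within [M] of
    [W] contribute to [E[g F]], and there the torus looks like the lattice, so
    [z] may be replaced by [y = phi(x)], which is i.i.d.  Taking for [g] the
    normalised information of [x] in [W], clipped at a level [L], gives
    [Var I_p <= Var I_q] up to an error that vanishes in the limit; the normalised
    information of [z] in a smaller block gives the other inequality. *)

Require Import Defs.
From HB Require Import structures.
From mathcomp Require Import all_boot all_order all_algebra finmap.
From mathcomp Require Import all_classical all_reals all_analysis.
From mathcomp Require Import measurable_realfun ring lra zify.
Import Order.TTheory GRing.Theory Num.Theory.
Local Open Scope ring_scope.

Set Implicit Arguments.
Unset Strict Implicit.
Unset Printing Implicit Defensive.

(** * Weighted means over a finite index set *)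

Section Mean.
Variables (R : realFieldType) (I : finType) (m : I -> R).
Implicit Types f g : I -> R.

Definition mean f : R := \sum_i m i * f i.

Lemma eq_mean f g : f =1 g -> mean f = mean g.
Proof. by move=> fg; apply: eq_bigr => i _; rewrite fg. Qed.

Lemma meanD f g : mean (fun i => f i + g i) = mean f + mean g.
Proof. by rewrite -big_split; apply: eq_bigr => i _; rewrite mulrDr. Qed.

Lemma meanZ k f : mean (fun i => k * f i) = k * mean f.
Proof. by rewrite mulr_sumr; apply: eq_bigr => i _; rewrite mulrCA. Qed.

Lemma meanN f : mean (fun i => - f i) = - mean f.
Proof. by rewrite -mulN1r -meanZ; apply: eq_mean => i; rewrite mulN1r. Qed.

Lemma meanB f g : mean (fun i => f i - g i) = mean f - mean g.
Proof. by rewrite meanD meanN. Qed.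

Lemma mean_sum (J : Type) (r : seq J) (Q : pred J) (f : J -> I -> R) :
  mean (fun i => \sum_(j <- r | Q j) f j i) = \sum_(j <- r | Q j) mean (f j).
Proof.
by rewrite exchange_big; apply: eq_bigr => i _; rewrite mulr_sumr.
Qed.

Lemma ler_mean f g : (forall i, 0 <= m i) ->
  (forall i, 0 < m i -> f i <= g i) -> mean f <= mean g.
Proof.
move=> m0 fg; apply: ler_sum => i _.
have := m0 i; rewrite le_eqVlt => /predU1P[<-|mi]; first by rewrite !mul0r.
by rewrite ler_wpM2l ?m0 ?fg.
Qed.

Lemma mean_ge0 f : (forall i, 0 <= m i) ->
  (forall i, 0 < m i -> 0 <= f i) -> 0 <= mean f.
Proof.
move=> m0 f0; apply: le_trans (ler_mean (f := fun=> 0) m0 f0).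
by rewrite /mean big1 // => i _; rewrite mulr0.
Qed.

Lemma ler_norm_mean f g : (forall i, 0 <= m i) ->
  (forall i, 0 < m i -> `|f i| <= g i) -> `|mean f| <= mean g.
Proof.
move=> m0 fg; rewrite ler_norml -meanN; apply/andP; split; apply: ler_mean => // i.
  by move=> /fg; rewrite ler_norml => /andP[].
by move=> /fg; rewrite ler_norml => /andP[].
Qed.

Lemma sum_sqr_le f K : (forall i, 0 <= m i) -> \sum_i m i = 1 ->
  (forall i, `|f i| <= K) -> \sum_i m i * f i ^+ 2 <= K ^+ 2.
Proof.
move=> m0 m1 fK; rewrite -[leRHS]mul1r -m1 mulr_suml; apply: ler_sum => i _.
by rewrite ler_wpM2l // -real_normK ?num_real // lerXn2r ?nnegrE // (le_trans _ (fK i)).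
Qed.
End Mean.

(** * Product weights, independence and moments of centred sums *)

Section ProductMean.
Variables (R : realFieldType) (T A : finType) (p : A -> R).

Definition weight (w : {ffun T -> A}) : R := \prod_t p (w t).

Local Notation expect := (mean weight).

Definition depends_on (C : Type) (V : {set T}) (f : {ffun T -> A} -> C) :=
  forall w w' : {ffun T -> A}, {in V, w =1 w'} -> f w = f w'.

Hypothesis p_ge0 : forall a, 0 <= p a.
Hypothesis p_sum1 : \sum_a p a = 1.

Lemma weight_ge0 w : 0 <= weight w.
Proof. exact: prodr_ge0. Qed.

Lemma mean_cst k : expect (fun=> k) = k.
Proof.
rewrite /mean -mulr_suml -(bigA_distr_bigA (fun=> p)) /=.
by rewrite big1 ?mul1r // => i _; rewrite p_sum1.
Qed.

Definition mix (V : {set T}) (w w' : {ffun T -> A}) : {ffun T -> A} :=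
  [ffun t => if t \in V then w t else w' t].

Lemma mixK V : involutive (fun u : {ffun T -> A} * {ffun T -> A} =>
  (mix V u.1 u.2, mix V u.2 u.1)).
Proof.
have mixE w w' : mix V (mix V w w') (mix V w' w) = w.
  by apply/ffunP => t; rewrite /mix !ffunE; case: ifP => // tV; rewrite ?ffunE ?tV.
by case=> w w' /=; rewrite !mixE.
Qed.

(* Exchanging the coordinates outside [V] between two independent copies of
   [w] preserves their joint law. *)
Lemma meanM V f g : depends_on V f -> depends_on (~: V) g ->
  expect (fun w => f w * g w) = expect f * expect g.
Proof.
move=> fV gV; transitivity
  (\sum_(u : {ffun T -> A} * {ffun T -> A})
     weight u.1 * weight u.2 * (f u.1 * g u.1)).
  rewrite -(pair_bigA _ (fun w w' => weight w * weight w' * (f w * g w))) /=.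
  apply: eq_bigr => w _; rewrite -mulr_suml -mulr_sumr.
  have := mean_cst 1; rewrite /mean => E1.
  by under eq_bigr do rewrite -[weight _]mulr1; rewrite E1 mulr1.
rewrite (reindex_inj (inv_inj (mixK V))) /=.
rewrite /mean mulr_suml; under [RHS]eq_bigr do rewrite mulr_sumr.
rewrite pair_bigA; apply: eq_bigr => -[w w'] _ /=.
rewrite (fV _ w); last by move=> t tV; rewrite ffunE tV.
rewrite (gV _ w'); last by move=> t; rewrite inE ffunE => /negbTE ->.
suff -> : weight (mix V w w') * weight (mix V w' w) = weight w * weight w'.
  by ring.
rewrite -!big_split; apply: eq_bigr => t _ /=; rewrite !ffunE.
by case: ifP => _ //; rewrite mulrC.
Qed.

Lemma mean_coord (t : T) (c : A -> R) :
  expect (fun w => c (w t)) = \sum_a p a * c a.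
Proof.
pose F s a := if s == t then p a * c a else p a.
transitivity (\sum_(w : {ffun T -> A}) \prod_s F s (w s)).
  apply: eq_bigr => w _; rewrite /weight (bigD1 t) // [in RHS](bigD1 t) //= /F eqxx.
  rewrite mulrAC; congr (_ * _); apply: eq_bigr => s /negbTE -> //.
rewrite -(bigA_distr_bigA F) (bigD1 t) //= /F eqxx.
rewrite [X in _ * X]big1 ?mulr1 //.
by move=> s /negbTE st; under eq_bigr do rewrite st.
Qed.

Lemma depends_on_coord (V : {set T}) t (c : A -> R) :
  t \in V -> depends_on V (fun w => c (w t)).
Proof. by move=> tV w w' /(_ _ tV) ->. Qed.

Lemma depends_on_sum (I : Type) (r : seq I) (Q : pred I) (V : {set T})
    (f : I -> _ -> R) :
  (forall i, Q i -> depends_on V (f i)) ->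
  depends_on V (fun w => \sum_(i <- r | Q i) f i w).
Proof. by move=> fV w w' ww'; apply: eq_bigr => i Qi; exact: fV. Qed.

Section CenteredSums.
Variables (c : A -> R) (K : R).
Hypothesis c_mean0 : \sum_a p a * c a = 0.
Hypothesis c_bound : forall a, `|c a| <= K.

Definition site_sum (V : {set T}) (w : {ffun T -> A}) : R := \sum_(t in V) c (w t).

Lemma depends_on_site_sum V : depends_on V (site_sum V).
Proof. by apply: depends_on_sum => t tV; exact: depends_on_coord. Qed.

Lemma mean_mul_coord0 V g t : depends_on V g -> t \notin V ->
  expect (fun w => g w * c (w t)) = 0.
Proof.
move=> gV tV; rewrite (meanM gV) ?mean_coord ?c_mean0 ?mulr0 //.
by apply: depends_on_coord; rewrite inE.
Qed.

(** The sites of [V'] outside [V] are independent of [g], and [c] is centred, so they contribute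
    nothing. *)
Lemma mean_mul_site_sum (V V' : {set T}) g : depends_on V g -> V \subset V' ->
  expect (fun w => g w * site_sum V' w) = expect (fun w => g w * site_sum V w).
Proof.
move=> gV VV'; under eq_mean do rewrite mulr_sumr.
rewrite mean_sum (big_setID V) /= (finset.setIidPr VV') [X in _ + X]big1 ?addr0.
  by rewrite -mean_sum; apply: eq_mean => w; rewrite mulr_sumr.
by move=> t; rewrite inE => /andP[tV _]; exact: mean_mul_coord0 gV tV.
Qed.

Let s2 := \sum_a p a * c a ^+ 2.

(** Induction on the list: the new site is independent of the earlier ones, so every cross term with
    a factor of degree one vanishes. For the fourth moment the induction closes because
    [3 * k ^ 2 + 6 * k + 1 <= 3 * (k + 1) ^ 2], in units of [K ^+ 4]. *)
Lemma site_sum_moments (s : seq T) : uniq s ->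
  let S w := \sum_(t <- s) c (w t) in
  [/\ expect S = 0, expect (fun w => S w ^+ 2) = (size s)%:R * s2 &
      expect (fun w => S w ^+ 4) <= 3 * (size s)%:R ^+ 2 * K ^+ 4].
Proof.
have K_ge0 (a : A) : 0 <= K.
  exact: le_trans (normr_ge0 (c a)) (c_bound a).
have KE (w : {ffun T -> A}) t n : c (w t) ^+ n <= K ^+ n.
  apply: le_trans (ler_norm _) _; rewrite normrX lerXn2r ?nnegrE //.
  exact: K_ge0 (w t).
elim: s => [_|t s IHs /= /andP[ts us]].
  split; rewrite /= ?mul0r; under eq_mean do rewrite big_nil ?expr0n /=;
  by rewrite mean_cst // expr0n /= mulr0 mul0r.
have {IHs} [E1 E2 E4] := IHs us.
set S := fun w => _ in E1 E2 E4.
pose V := [set t0 in s].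
have SV n : depends_on V (fun w => S w ^+ n).
  move=> w w' ww'; congr (_ ^+ _); apply: eq_big_seq => u us'.
  by rewrite ww' // inE.
have cV n : depends_on (~: V) (fun w => c (w t) ^+ n).
  by apply: (@depends_on_coord _ t (fun a => c a ^+ n)); rewrite !inE.
have E m n : expect (fun w => S w ^+ m * c (w t) ^+ n) =
    expect (fun w => S w ^+ m) * \sum_a p a * c a ^+ n.
  by rewrite (meanM (SV m) (cV n)) (mean_coord t (fun a => c a ^+ n)).
have c1 : \sum_a p a * c a ^+ 1 = 0 by rewrite -[RHS]c_mean0; under eq_bigr do rewrite expr1.
have s2K : s2 <= K ^+ 2 by exact: sum_sqr_le.
have s2_ge0 : 0 <= s2 by apply: sumr_ge0 => a _; rewrite mulr_ge0 ?sqr_ge0.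
split.
- under eq_mean do rewrite big_cons.
  by rewrite meanD E1 addr0 (mean_coord t c).
- transitivity (expect (fun w => S w ^+ 2 +
      (2 * (S w ^+ 1 * c (w t) ^+ 1) + c (w t) ^+ 2))).
    by apply: eq_mean => w; rewrite big_cons -/(S w); ring.
  rewrite !meanD meanZ E c1 mulr0 mulr0 add0r E2.
  by rewrite (mean_coord t (fun a => c a ^+ 2)) -/s2 -natr1; ring.
- have -> : expect (fun w => (\sum_(j <- t :: s) c (w j)) ^+ 4) =
     expect (fun w => S w ^+ 4 + (4 * (S w ^+ 3 * c (w t) ^+ 1) +
      (6 * (S w ^+ 2 * c (w t) ^+ 2) +
       (4 * (S w ^+ 1 * c (w t) ^+ 3) + c (w t) ^+ 4)))).
    by apply: eq_mean => w; rewrite big_cons -/(S w); ring.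
  rewrite !meanD !meanZ !E c1 mulr0 mulr0 add0r E2.
  have -> : expect (fun w => S w ^+ 1) = 0.
    by rewrite -[RHS]E1; apply: eq_mean => w; rewrite expr1.
  rewrite mul0r mulr0 add0r -/s2.
  have c4 : expect (fun w => c (w t) ^+ 4) <= K ^+ 4.
    by rewrite -[leRHS]mean_cst; apply: ler_mean => [|w _]; [exact: weight_ge0|]; exact: KE.
  have s22 : s2 * s2 <= K ^+ 4.
    have -> : K ^+ 4 = K ^+ 2 * K ^+ 2 by ring.
    exact: ler_pM.
  have : (size s)%:R * (s2 * s2) <= (size s)%:R * K ^+ 4 by rewrite ler_wpM2l.
  have K4 : 0 <= K ^+ 4 by rewrite exprn_even_ge0.
  rewrite -[expect _]/(expect (fun w => S w ^+ 4)) in E4.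
  rewrite -[(size s).+1%:R]natr1; move: E4 c4 K4 (ler0n R (size s)).
  move: (expect (fun w => S w ^+ 4)) (expect (fun w => c (w t) ^+ 4)) ((size s)%:R) s2 (K ^+ 4).
  by clear => e e1 k t K4 *; nra.
Qed.

Lemma mean_site_sum_sqr V :
  expect (fun w => site_sum V w ^+ 2) = #|V|%:R * s2.
Proof.
have [_ + _] := site_sum_moments (enum_uniq V); rewrite -cardE => <-.
by apply: eq_mean => w; rewrite big_enum.
Qed.

Lemma mean_site_sum_pow4 V :
  expect (fun w => site_sum V w ^+ 4) <= 3 * #|V|%:R ^+ 2 * K ^+ 4.
Proof.
have [_ _] := site_sum_moments (enum_uniq V); rewrite -cardE; apply: le_trans.
by rewrite (@eq_mean _ _ _ _ (fun w => site_sum V w ^+ 4)) // => w; rewrite big_enum.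
Qed.

End CenteredSums.
End ProductMean.

(** * Clipping at a level, and inequalities for clipped products *)

Section Clip.
Variable R : realFieldType.
Implicit Types x y L : R.

Definition clip L x : R := Num.max (- L) (Num.min L x).

Lemma clip_cases L x : 0 <= L ->
  [\/ x < - L /\ clip L x = - L, - L <= x <= L /\ clip L x = x |
      L < x /\ clip L x = L].
Proof.
move=> L0; rewrite /clip.
have [xL|Lx] := ltP x (- L).
  apply: Or31; split => //.
  have /min_idPr -> : x <= L by lra.
  by apply/max_idPl; rewrite ltW.
have [xL|xL] := leP x L.
  by apply: Or32; split => //; apply/max_idPr.
by apply: Or33; split => //; apply/max_idPr; lra.
Qed.

Lemma clip_bound L x : 0 <= L -> `|clip L x| <= L.
Proof.
by move=> L0; rewrite ler_norml; case: (clip_cases x L0) => -[+ ->]; lra.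
Qed.

Lemma clip_sqr_le L x : 0 <= L -> clip L x ^+ 2 <= x ^+ 2.
Proof. by move=> L0; case: (clip_cases x L0) => -[+ ->]; nra. Qed.

Lemma clip_lipschitz L x y : 0 <= L -> `|clip L x - clip L y| <= `|x - y|.
Proof.
move=> L0; have := ler_norm (x - y); have := ler_norm (y - x); rewrite distrC.
rewrite ler_norml; move: `|_| => r.
by case: (clip_cases x L0) => -[+ ->]; case: (clip_cases y L0) => -[+ ->]; lra.
Qed.

(** Clipping loses something only where [x] exceeds [L] in absolute value; there
    [x ^+ 2 <= x ^+ 4 / L ^+ 2], and the product stays nonnegative. A fourth moment thus controls
    the truncation error. *)
Lemma clip_mul_ge L x : 0 < L -> x ^+ 2 - x ^+ 4 / L ^+ 2 <= clip L x * x.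
Proof.
move=> L0; have L2 : 0 < L ^+ 2 by rewrite exprn_gt0.
have x2 : 0 <= x ^+ 2 by exact: sqr_ge0.
have x4 : x ^+ 4 = x ^+ 2 * x ^+ 2 by ring.
have [|[] /andP[_ _] ->|] := clip_cases x (ltW L0).
- case=> xL ->; apply: (@le_trans _ _ 0); last by nra.
  by rewrite subr_le0 ler_pdivlMr // x4 ler_wpM2l //; nra.
- by rewrite -expr2 lerBlDr lerDl divr_ge0 ?(ltW L2) // x4 mulr_ge0.
- case=> xL ->; apply: (@le_trans _ _ 0); last by nra.
  by rewrite subr_le0 ler_pdivlMr // x4 ler_wpM2l //; nra.
Qed.

Lemma le_double (a b c d : R) : a - c <= d + 2^-1 * (a + b) -> a <= b + 2 * c + 2 * d.
Proof. by lra. Qed.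

Lemma mul_le_half_sqr x y z : x ^+ 2 <= z ^+ 2 -> x * y <= 2^-1 * (z ^+ 2 + y ^+ 2).
Proof. by have := sqr_ge0 (x - y); lra. Qed.

(* In the application [x] and [y] are clipped at [L], [y] being the clipped
   value of [u]. *)
Lemma perturbed_mul_ge L d x y s t u : 1 <= L -> `|x| <= L -> `|y| <= L ->
    y ^+ 2 <= u ^+ 2 -> `|x - y| <= d ->
  y * t - (L ^+ 2 + L) * d - (2 * L)^-1 * t ^+ 2 - 2^-1 * (u ^+ 2 + s ^+ 2) <=
  - (x * (s - t)).
Proof.
move=> L1 xL yL yu xyd; have L0 : 0 < L by lra.
have D2 : `|x - y| <= 2 * L by apply: le_trans (ler_normB _ _) _; lra.
have H1 : (y - x) * t <= L ^+ 2 * d + (2 * L)^-1 * t ^+ 2.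
  apply: le_trans (ler_norm _) _; rewrite normrM distrC -(real_normK (num_real t)).
  move: D2 xyd (normr_ge0 (x - y)); move: `|x - y| `|t| => D m D2 Dd D0.
  (* This square gives [D * m <= L / 2 * D ^+ 2 + (2 * L)^-1 * m ^+ 2], and [D <= 2 * L] bounds the
     first term by [L ^+ 2 * D]. *)
  have : 0 <= (2 * L)^-1 * (L * D - m) ^+ 2 by rewrite mulr_ge0 ?sqr_ge0 // invr_ge0; lra.
  have -> : (2 * L)^-1 * (L * D - m) ^+ 2 = L / 2 * D ^+ 2 - D * m + (2 * L)^-1 * m ^+ 2.
    by field; rewrite gt_eqF.
  have : L ^+ 2 * D <= L ^+ 2 * d by rewrite ler_wpM2l ?sqr_ge0.
  have : L * (D * D) <= L * (D * (2 * L)) by rewrite !ler_wpM2l // ltW.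
  by move: (_ * m ^+ 2) => ?; lra.
have H2 : x ^+ 2 - y ^+ 2 <= 2 * L * d.
  rewrite subr_sqr; apply: le_trans (ler_norm _) _; rewrite normrM mulrC.
  by rewrite ler_pM //; apply: le_trans (ler_normD _ _) _; lra.
have := sqr_ge0 (x - s).
by move: H1 H2 yu; move: (_ * t ^+ 2) => z *; lra.
Qed.

(** The averaged form of [perturbed_mul_ge]: [a], [b], [w] stand for the means of [u ^+ 2],
    [s ^+ 2], [t ^+ 2], [d] for the mean distance, [m] for the mean of [y * t] with truncation error
    [c], and [x] for the mean of the product that [r] controls. *)
Lemma perturbed_mul_ge_sum L d d' m w w' a b c r x : 1 <= L -> d <= d' -> w <= w' ->
    m - (L ^+ 2 + L) * d - (2 * L)^-1 * w - 2^-1 * (a + b) <= - x ->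
    a - c <= m -> - r <= x ->
  a <= b + 2 * c + w' / L + 2 * (L ^+ 2 + L) * d' + 2 * r.
Proof.
move=> L1 dd' ww'.
have : (L ^+ 2 + L) * d <= (L ^+ 2 + L) * d' by rewrite ler_wpM2l //; nra.
have : (2 * L)^-1 * w <= (2 * L)^-1 * w' by rewrite ler_wpM2l // invr_ge0; lra.
have -> : (2 * L)^-1 * w' = 2^-1 * (w' / L) by field; lra.
lra.
Qed.
End Clip.

(** * Centred sums normalised by the square root of the volume *)

Section ScaledSiteSums.
Variables (R : realFieldType) (T A : finType) (p : A -> R).
Hypotheses (p_ge0 : forall a, 0 <= p a) (p_sum1 : \sum_a p a = 1).
Variables (c : A -> R) (K rho L : R).
Hypotheses (c_mean0 : \sum_a p a * c a = 0) (c_bound : forall a, `|c a| <= K).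
Hypotheses (rho_gt0 : 0 < rho) (rho_sqr : rho ^+ 2 = #|T|%:R) (L_gt0 : 0 < L).

Lemma scaled_site_sum_sqr (V : {set T}) :
  mean (weight p) (fun w => (site_sum c V w / rho) ^+ 2) =
    #|V|%:R / #|T|%:R * \sum_a p a * c a ^+ 2.
Proof.
under eq_mean do rewrite expr_div_n mulrC.
rewrite meanZ (mean_site_sum_sqr p_ge0 p_sum1 c_mean0 c_bound) rho_sqr.
by rewrite mulrA [_^-1 * _]mulrC.
Qed.

Lemma scaled_site_sum_pow4 (V : {set T}) :
  mean (weight p) (fun w => (site_sum c V w / rho) ^+ 4) <= 3 * K ^+ 4.
Proof.
under eq_mean do rewrite expr_div_n mulrC.
rewrite meanZ mulrC ler_pdivrMr ?exprn_gt0 //.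
apply: le_trans (mean_site_sum_pow4 p_ge0 p_sum1 c_mean0 c_bound V) _.
have -> : rho ^+ 4 = #|T|%:R ^+ 2 by rewrite -rho_sqr; ring.
have K4 : 0 <= K ^+ 4 by rewrite exprn_even_ge0.
rewrite mulrAC ler_wpM2l //; first by rewrite mulr_ge0 // ler0n.
by rewrite lerXn2r ?nnegrE // ler_nat max_card.
Qed.

Lemma clip_site_sum_mean_ge (V : {set T}) :
  #|V|%:R / #|T|%:R * (\sum_a p a * c a ^+ 2) - 3 * K ^+ 4 / L ^+ 2 <=
  mean (weight p)
    (fun w => clip L (site_sum c V w / rho) * (site_sum c V w / rho)).
Proof.
apply: le_trans (ler_mean (weight_ge0 p_ge0) (fun w _ => clip_mul_ge _ L_gt0)).
rewrite meanB scaled_site_sum_sqr lerD2l lerN2.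
under eq_mean do rewrite mulrC.
rewrite meanZ mulrC ler_pM2r ?invr_gt0 ?exprn_gt0 //.
exact: scaled_site_sum_pow4.
Qed.
End ScaledSiteSums.

(** * Comparison of the variances of two coupled product laws *)

Section Comparison.
Variables (R : realFieldType) (T A B : finType) (p : A -> R) (q : B -> R).
Hypotheses (p_ge0 : forall a, 0 <= p a) (p_sum1 : \sum_a p a = 1).
Hypotheses (q_ge0 : forall b, 0 <= q b) (q_sum1 : \sum_b q b = 1).
Variables (ca : A -> R) (cb : B -> R) (K : R).
Hypotheses (ca_mean0 : \sum_a p a * ca a = 0) (cb_mean0 : \sum_b q b * cb b = 0).
Hypotheses (ca_bound : forall a, `|ca a| <= K) (cb_bound : forall b, `|cb b| <= K).

Variable P : {ffun T -> A} * {ffun T -> B} -> R.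
Hypothesis P_ge0 : forall o, 0 <= P o.
Hypothesis P_fst : forall f, mean P (fun o => f o.1) = mean (weight p) f.
Hypothesis P_snd : forall f, mean P (fun o => f o.2) = mean (weight q) f.

Variables (U W W' : {set T}) (zeta : T -> {ffun T -> A} -> R) (kappa : R).
Hypotheses (UW' : U \subset W') (WW' : W \subset W').
(* [ca] and [cb] are the centred information functions, [P] is the joint law of
   [x] and [y], and [zeta] is the part of [cb (y t)] known from [x] alone. *)
Let f t (w : {ffun T -> A}) := ca (w t) - zeta t w.
Let e t (o : {ffun T -> A} * {ffun T -> B}) := cb (o.2 t) - zeta t o.1.

Hypothesis f_sum_ge0 : forall w, 0 < weight p w -> 0 <= \sum_t f t w.
Hypothesis f_mean : forall t, 0 <= mean (weight p) (f t) <= kappa.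
Hypothesis e_ge0 : forall t o, t \in W' -> 0 < P o -> 0 <= e t o.
Hypothesis f_outer : forall t, t \notin W' -> depends_on (~: W) (f t).
Hypothesis zeta_inner : forall t, t \in U -> depends_on W (zeta t).

Let S V (o : {ffun T -> A} * {ffun T -> B}) := site_sum ca V o.1.
Let Y V (o : {ffun T -> A} * {ffun T -> B}) := site_sum cb V o.2.

(** Both means equal minus that of [zeta t], because [ca] and [cb] are centred. *)
Lemma mean_error t : mean P (e t) = mean (weight p) (f t).
Proof.
rewrite [LHS]meanB (P_snd (fun w => cb (w t))) (P_fst (zeta t)).
rewrite [RHS]meanB (mean_coord q_sum1) cb_mean0.
by rewrite (mean_coord p_sum1 t ca) ca_mean0.
Qed.

(** The mean splits into three parts: the sum of [f] over the whole torus, minus the part outside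
    [W'], where [f] is independent of [g], minus the errors [e] inside [W']. In each part a
    nonnegative quantity, or a nonnegative mean, is at most [kappa] per site. The parts count
    [#|T|], [#|~: W'|] and [#|W'|] sites, whence the factor 2. *)
Lemma mean_mul_difference g L : 0 <= L -> depends_on W g ->
  (forall w, `|g w| <= L) ->
  `|mean P (fun o => g o.1 * (S W o - Y W' o))| <= 2 * L * #|T|%:R * kappa.
Proof.
move=> L0 gW gL; have w0 := weight_ge0 p_ge0.
have kappa0 : T -> 0 <= kappa.
  by move=> t; have /andP[] := f_mean t; exact: le_trans.
have -> : mean P (fun o => g o.1 * (S W o - Y W' o)) =
    mean (weight p) (fun w => g w * \sum_t f t w)
    - \sum_(t in ~: W') mean (weight p) g * mean (weight p) (f t)
    - \sum_(t in W') mean P (fun o => g o.1 * e t o).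
  under [X in _ = X - _ - _]eq_mean do rewrite mulr_sumr.
  rewrite mean_sum (bigID [in W']) /=.
  rewrite [X in _ + X - _ - _](eq_bigr
    (fun t => mean (weight p) g * mean (weight p) (f t))); last first.
    by move=> t tW'; rewrite (meanM p_sum1 gW (f_outer tW')).
  rewrite [X in _ - X - _](eq_bigl [predC W']); last by move=> t; rewrite !inE.
  rewrite addrK -sumrB.
  (* Enlarging [W] to [W'] in the first sum changes nothing, since [g] depends on [W] only; the two
     sums then run over the same sites. *)
  transitivity (mean P (fun o => g o.1 * S W' o) - mean P (fun o => g o.1 * Y W' o)).
    rewrite (P_fst (fun w => g w * site_sum ca W' w)).
    rewrite (mean_mul_site_sum p_sum1 ca_mean0 gW WW').
    rewrite -(P_fst (fun w => g w * site_sum ca W w)) -meanB.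
    by apply: eq_mean => o; rewrite mulrBr.
  rewrite -meanB.
  transitivity (mean P (fun o => \sum_(t in W') (g o.1 * f t o.1 - g o.1 * e t o))).
    apply: eq_mean => o; rewrite -mulrBr -sumrB mulr_sumr; apply: eq_bigr => t _.
    by rewrite /f /e; ring.
  rewrite mean_sum; apply: eq_bigr => t _.
  by rewrite meanB (P_fst (fun w => g w * f t w)).
have B1 : `|mean (weight p) (fun w => g w * \sum_t f t w)| <= L * (#|T|%:R * kappa).
  apply: (@le_trans _ _ (mean (weight p) (fun w => L * \sum_t f t w))).
    apply: ler_norm_mean => // w wp; rewrite normrM ler_pM //.
    by rewrite ger0_norm ?f_sum_ge0.
  rewrite meanZ ler_wpM2l // mean_sum mulr_natl -sumr_const.
  by apply: ler_sum => t _; have /andP[] := f_mean t.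
have g1 : `|mean (weight p) g| <= L.
  rewrite -[leRHS](mean_cst T p_sum1); exact: ler_norm_mean.
have B2 : `|\sum_(t in ~: W') mean (weight p) g * mean (weight p) (f t)| <=
    L * (#|~: W'|%:R * kappa).
  apply: le_trans (ler_norm_sum _ _ _) _.
  rewrite mulr_natl -sumr_const mulr_sumr; apply: ler_sum => t _.
  by have /andP[f0 f1] := f_mean t; rewrite normrM ler_pM // ger0_norm.
have B3 : `|\sum_(t in W') mean P (fun o => g o.1 * e t o)| <=
    L * (#|W'|%:R * kappa).
  apply: le_trans (ler_norm_sum _ _ _) _.
  rewrite mulr_natl -sumr_const mulr_sumr; apply: ler_sum => t tW'.
  apply: (@le_trans _ _ (mean P (fun o => L * e t o))).
    apply: ler_norm_mean => // o Po; rewrite normrM ler_pM //.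
    by rewrite ger0_norm ?e_ge0.
  by rewrite meanZ mean_error ler_wpM2l //; have /andP[] := f_mean t.
have NW : #|T|%:R = #|W'|%:R + #|~: W'|%:R :> R by rewrite -natrD cardsC.
apply: le_trans (ler_normB _ _) _; apply: le_trans (lerD (ler_normB _ _) B3) _.
rewrite -addrA; apply: le_trans (lerD B1 (lerD B2 (lexx _))) _.
by rewrite NW le_eqVlt; apply/orP; left; apply/eqP; ring.
Qed.

Variables (rho L : R).
Hypotheses (rho_gt0 : 0 < rho) (rho_sqr : rho ^+ 2 = #|T|%:R) (L_ge1 : 1 <= L).

Let s2p := \sum_a p a * ca a ^+ 2.
Let s2q := \sum_b q b * cb b ^+ 2.

Lemma mean_mul_scaled_difference g : depends_on W g -> (forall w, `|g w| <= L) ->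
  `|mean P (fun o => g o.1 * (S W o / rho - Y W' o / rho))| <= 2 * L * (rho * kappa).
Proof.
move=> gW gL; have L0 : 0 <= L by apply: le_trans L_ge1.
have -> : mean P (fun o => g o.1 * (S W o / rho - Y W' o / rho)) =
    rho^-1 * mean P (fun o => g o.1 * (S W o - Y W' o)).
  by rewrite -meanZ; apply: eq_mean => o; ring.
rewrite normrM gtr0_norm ?invr_gt0 // mulrC ler_pdivrMr //.
apply: le_trans (mean_mul_difference L0 gW gL) _.
by rewrite -rho_sqr le_eqVlt; apply/orP; left; apply/eqP; ring.
Qed.

(** The test function is the clipped normalised sum of [ca] over [W]. Its product with the image sum
    is at most half the sum of the two squares; absorbing half the variance on the left doubles the
    errors. *)
Lemma variance_le_image :
  #|W|%:R / #|T|%:R * s2p <= #|W'|%:R / #|T|%:R * s2q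
    + 6 * K ^+ 4 / L ^+ 2 + 4 * L * (rho * kappa).
Proof.
have L0 : 0 < L by apply: lt_le_trans L_ge1.
pose g w := clip L (site_sum ca W w / rho).
have gW : depends_on W g.
  by move=> w w' ww'; rewrite /g (depends_on_site_sum ca ww').
have /= := mean_mul_scaled_difference gW (fun w => clip_bound _ (ltW L0)).
rewrite ler_norml => /andP[_].
have -> : mean P (fun o => g o.1 * (S W o / rho - Y W' o / rho)) =
    mean (weight p) (fun w => g w * (site_sum ca W w / rho))
    - mean P (fun o => g o.1 * (Y W' o / rho)).
  rewrite -(P_fst (fun w => g w * (site_sum ca W w / rho))) -meanB.
  by apply: eq_mean => o; rewrite mulrBr.
have : #|W|%:R / #|T|%:R * s2p - 3 * K ^+ 4 / L ^+ 2 <=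
    mean (weight p) (fun w => g w * (site_sum ca W w / rho)).
  exact: clip_site_sum_mean_ge.
have : mean P (fun o => g o.1 * (Y W' o / rho)) <=
    2^-1 * (#|W|%:R / #|T|%:R * s2p + #|W'|%:R / #|T|%:R * s2q).
  rewrite -(scaled_site_sum_sqr p_ge0 p_sum1 ca_mean0 ca_bound rho_sqr W).
  rewrite -(scaled_site_sum_sqr q_ge0 q_sum1 cb_mean0 cb_bound rho_sqr W').
  rewrite -P_fst -P_snd -meanD -meanZ.
  apply: ler_mean => // o _.
  have := clip_sqr_le (S W o / rho) (ltW L0).
  by rewrite -/(g o.1); exact: mul_le_half_sqr.
move=> m2 m1 m12; have {m2 m1 m12} : #|W|%:R / #|T|%:R * s2p - 3 * K ^+ 4 / L ^+ 2 <=
    2 * L * (rho * kappa) +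
    2^-1 * (#|W|%:R / #|T|%:R * s2p + #|W'|%:R / #|T|%:R * s2q).
  by apply: le_trans m1 _; rewrite -lerBlDr; apply: le_trans m12; rewrite lerD2l lerN2.
move/le_double; congr (_ <= _); ring.
Qed.

(** The test function has to be a function of [x], so it is built from [zeta] on [U] instead of the
    image itself. Replacing it by its analogue [gy] for the image costs a mean distance of at most
    [rho * kappa]. *)
Lemma image_variance_le :
  #|U|%:R / #|T|%:R * s2q <= #|W|%:R / #|T|%:R * s2p
    + 6 * K ^+ 4 / L ^+ 2 + K ^+ 2 / L + 2 * (L ^+ 2 + 3 * L) * (rho * kappa).
Proof.
have L0 : 0 < L by apply: lt_le_trans L_ge1.
pose zU w := (\sum_(t in U) zeta t w) / rho.
pose g w := clip L (zU w).
have gW : depends_on W g.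
  move=> w w' ww'; rewrite /g /zU; congr (clip L (_ / _)).
  by apply: eq_bigr => t tU; apply: zeta_inner.
have /= := mean_mul_scaled_difference gW (fun w => clip_bound _ (ltW L0)).
rewrite ler_norml => /andP[+ _].
pose gy w := clip L (site_sum cb U w / rho).
have gyU : depends_on U gy.
  by move=> w w' ww'; rewrite /gy (depends_on_site_sum cb ww').
have D (o : {ffun T -> A} * {ffun T -> B}) : 0 < P o ->
    `|g o.1 - gy o.2| <= rho^-1 * \sum_(t in U) e t o.
  move=> Po; rewrite distrC; apply: le_trans (clip_lipschitz _ _ (ltW L0)) _.
  rewrite /zU /site_sum -mulrBl -sumrB mulrC ger0_norm //.
  rewrite mulr_ge0 ?invr_ge0 ?(ltW rho_gt0) //.
  by apply: sumr_ge0 => t tU; rewrite e_ge0 // (fintype.subsetP UW').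
have DE : mean P (fun o => rho^-1 * \sum_(t in U) e t o) <= rho * kappa.
  rewrite meanZ mulrC ler_pdivrMr // mulrAC -expr2 rho_sqr mean_sum.
  apply: (@le_trans _ _ (\sum_(t in U) kappa)).
    by apply: ler_sum => t _; rewrite mean_error; have /andP[] := f_mean t.
  (* The sign of [kappa] comes from [f_mean], which takes a site; without sites both cardinals
     vanish. *)
  rewrite sumr_const -[kappa *+ _]mulr_natl; have [t _|T0] := pickP T.
    rewrite ler_wpM2r ?ler_nat ?max_card //.
    by have /andP[] := f_mean t; exact: le_trans.
  by rewrite !eq_card0 // => t; have := T0 t.
have key : mean P (fun o => gy o.2 * (Y W' o / rho)
      - (L ^+ 2 + L) * (rho^-1 * \sum_(t in U) e t o)
      - (2 * L)^-1 * (Y W' o / rho) ^+ 2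
      - 2^-1 * ((Y U o / rho) ^+ 2 + (S W o / rho) ^+ 2)) <=
    - mean P (fun o => g o.1 * (S W o / rho - Y W' o / rho)).
  rewrite -meanN; apply: ler_mean => // o Po; have := D o Po.
  apply: perturbed_mul_ge => //; first exact: clip_bound (ltW L0).
    exact: clip_bound (ltW L0).
  exact: clip_sqr_le (ltW L0).
(* [gy] depends on [U] only, so the image sum over [W'] may be cut down to [U]. *)
have EU : mean P (fun o => gy o.2 * (Y W' o / rho)) =
    mean (weight q) (fun w => gy w * (site_sum cb U w / rho)).
  rewrite (P_snd (fun w => gy w * (site_sum cb W' w / rho))).
  have E V : mean (weight q) (fun w => gy w * (site_sum cb V w / rho)) =
      rho^-1 * mean (weight q) (fun w => gy w * site_sum cb V w).
    by rewrite -meanZ; apply: eq_mean => w; ring.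
  by rewrite !E (mean_mul_site_sum q_sum1 cb_mean0 gyU UW').
have K2 : #|W'|%:R / #|T|%:R * s2q <= K ^+ 2.
  have T_gt0 : 0 < #|T|%:R :> R by rewrite -rho_sqr exprn_gt0.
  rewrite -[leRHS]mul1r ler_pM ?divr_ge0 //.
  - by apply: sumr_ge0 => b _; rewrite mulr_ge0 ?sqr_ge0.
  - by rewrite ler_pdivrMr // mul1r ler_nat max_card.
  - exact: sum_sqr_le.
have : #|U|%:R / #|T|%:R * s2q - 3 * K ^+ 4 / L ^+ 2 <=
    mean (weight q) (fun w => gy w * (site_sum cb U w / rho)).
  exact: clip_site_sum_mean_ge.
move: key; rewrite !meanB !meanZ EU meanD.
rewrite (P_snd (fun w => (site_sum cb W' w / rho) ^+ 2)).
rewrite (P_snd (fun w => (site_sum cb U w / rho) ^+ 2)).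
rewrite (P_fst (fun w => (site_sum ca W w / rho) ^+ 2)).
rewrite (scaled_site_sum_sqr p_ge0 p_sum1 ca_mean0 ca_bound rho_sqr).
rewrite !(scaled_site_sum_sqr q_ge0 q_sum1 cb_mean0 cb_bound rho_sqr) -/s2p -/s2q.
rewrite -meanZ => key m1 m2.
have := perturbed_mul_ge_sum L_ge1 DE K2 key m1 m2.
by congr (_ <= _); field; rewrite -rho_sqr sqrf_eq0 !gt_eqF.
Qed.
End Comparison.

Local Open Scope classical_set_scope.
Local Open Scope ring_scope.

(** * Laws of finite-valued random variables *)

Section FiniteValued.
Context {disp : measure_display} {X : measurableType disp} {R : realType}.
Variable mu : probability X R.

Definition fin_measurable (C : finType) (f : X -> C) :=
  forall c, measurable [set x | f x = c].

Definition law (C : finType) (f : X -> C) (c : C) : R := fine (mu [set x | f x = c]).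

Lemma lawE (C : finType) (f : X -> C) c : fin_measurable f ->
  mu [set x | f x = c] = (law f c)%:E.
Proof. by move=> mf; rewrite /law fineK // fin_num_measure. Qed.

Lemma law_ge0 (C : finType) (f : X -> C) c : 0 <= law f c.
Proof. by rewrite /law fine_ge0. Qed.

Lemma fin_measurable_bigcup (C : finType) (f : X -> C) (Q : pred C) :
  [set x | Q (f x)] = \bigcup_(c in [set` [seq c <- enum C | Q c]]) [set x | f x = c].
Proof.
apply/seteqP; split => [x Qx|x [c /= + ->]].
  by exists (f x) => //=; rewrite mem_filter Qx mem_enum.
by rewrite mem_filter => /andP[].
Qed.

Lemma measurable_fin_preimage (C : finType) (f : X -> C) (Q : pred C) :
  fin_measurable f -> measurable [set x | Q (f x)].
Proof.
by move=> mf; rewrite fin_measurable_bigcup; exact: fin_bigcup_measurable.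
Qed.

Lemma measure_fin_preimage (C : finType) (f : X -> C) (Q : pred C) :
  fin_measurable f -> mu [set x | Q (f x)] = (\sum_(c | Q c) law f c)%:E.
Proof.
move=> mf; rewrite fin_measurable_bigcup measure_fin_bigcup //; last first.
  by move=> i j _ _ [x [/= <- <-]].
rewrite -fsbig_seq; last by rewrite filter_uniq ?enum_uniq.
rewrite big_filter big_enum_cond /= -sumEFin.
by apply: eq_bigr => c _; exact: lawE.
Qed.

Lemma fin_measurable_pair (C C' : finType) (f : X -> C) (g : X -> C') :
  fin_measurable f -> fin_measurable g -> fin_measurable (fun x => (f x, g x)).
Proof.
move=> mf mg [c c']; have := measurableI _ _ (mf c) (mg c').
by congr (measurable _); apply/seteqP; split => x /= [-> ->].
Qed.

Lemma mean_law_comp (C C' : finType) (f : X -> C) (h : C -> C') (g : C' -> R) :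
  fin_measurable f -> mean (law (h \o f)) g = mean (law f) (fun c => g (h c)).
Proof.
move=> mf; rewrite /mean (partition_big h predT) //=; apply: eq_bigr => c _.
have -> : law (h \o f) c = \sum_(c' | h c' == c) law f c'.
  rewrite /law; have := measure_fin_preimage (fun c' => h c' == c) mf.
  rewrite (_ : [set x | _ == c] = [set x | h (f x) = c]) ?[fine _]/law => [->//|].
  by apply/seteqP; split => x /= /eqP.
by rewrite mulr_suml; apply: eq_bigr => c' /eqP <-.
Qed.

Lemma integral_fin (C : finType) (f : X -> C) (g : C -> R) :
  fin_measurable f -> (forall c, 0 <= g c) ->
  (\int[mu]_x (g (f x))%:E = (mean (law f) g)%:E)%E.
Proof.
move=> mf g0.
transitivity (\int[mu]_x \sum_(c <- enum C) ((g c)%:E * (\1_[set x | f x = c] x)%:E))%E.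
  apply: eq_integral => x _; rewrite big_enum /= (bigD1 (f x)) //=.
  rewrite indicE mem_set // mule1 big1 ?adde0 // => c cfx.
  rewrite indicE memNset ?mule0 //= => fxc.
  by rewrite fxc eqxx in cfx.
rewrite ge0_integral_sum //; last 2 first.
- by move=> c; apply/measurable_funeM/measurable_EFinP; exact: measurable_indic.
- by move=> c x _; rewrite mule_ge0 ?lee_fin.
rewrite big_enum /= -sumEFin; apply: eq_bigr => c _.
rewrite ge0_integralZl_EFin //; last first.
  by apply/measurable_EFinP; exact: measurable_indic.
rewrite mulrC EFinM (integral_indic _ measurableT (mf c)) setIT.
by congr (_ * _)%E; exact: lawE.
Qed.

End FiniteValued.

(** * Cylinder events and shift invariance of the i.i.d. measure *)

Section Cylinders.
Variables (d : nat) (A : finType) (a0 : A).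
Local Notation Omega := (Omega d a0).

Definition restr (I : finType) (s : I -> site d) (x : Omega) : {ffun I -> A} :=
  [ffun i => x (s i)].

Lemma measurable_coord v a : measurable [set x : Omega | x v = a].
Proof. by apply: sub_sigma_algebra; exists v, a. Qed.

Lemma fin_measurable_restr (I : finType) (s : I -> site d) :
  fin_measurable (restr s).
Proof.
move=> w; have -> : [set x | restr s x = w] =
    \bigcap_(i in [set: I]) [set x : Omega | x (s i) = w i].
  apply/seteqP; split => [x /= <- i _|x xw]; first by rewrite ffunE.
  by apply/ffunP => i; rewrite ffunE; apply: xw.
by apply: fin_bigcap_measurable => // i _; exact: measurable_coord.
Qed.

Lemma measurable_shift (u : site d) : measurable_fun setT (Defs.shift u : Omega -> Omega).
Proof.
apply: (@measurability _ _ Omega Omega _ _ (@coord_events d A a0)) => //.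
move=> _ [_ [v [a ->]] <-]; rewrite setTI.
exact: measurable_coord.
Qed.

Section Iid.
Variables (R : realType) (p : A -> R) (mu : probability Omega R).
Hypothesis mu_iid : iid_measure p mu.

(** The predicate [Q] leaves some of the indexed sites unconstrained, as is wanted for the uncoded
    ones. *)
Lemma iid_cylinder (I : finType) (Q : pred I) (s : I -> site d) (w : I -> A) :
  injective s ->
  mu [set x : Omega | forall i, Q i -> x (s i) = w i] = (\prod_(i | Q i) p (w i))%:E.
Proof.
move=> s_inj.
pose w' v := if [pick i | s i == v] is Some i then w i else a0.
have w's i : w' (s i) = w i.
  rewrite /w'; case: pickP => [j /eqP /s_inj -> //|/(_ i)].
  by rewrite eqxx.
have -> : [set x : Omega | forall i, Q i -> x (s i) = w i] =
    [set x : Omega | forall v, v \in [fset s i | i in Q]%fset -> x v = w' v].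
  apply/seteqP; split => x /= xw.
    by move=> v /imfsetP[i Qi ->]; rewrite w's xw.
  by move=> i Qi; rewrite xw ?w's //; apply/imfsetP; exists i.
rewrite mu_iid /= big_imfset /=; last by move=> i j _ _; exact: s_inj.
by rewrite big_enum; congr EFin; apply: eq_bigr => i _; rewrite w's.
Qed.

Lemma law_restr (I : finType) (s : I -> site d) : injective s ->
  law mu (restr s) =1 weight p.
Proof.
move=> s_inj w; rewrite /weight -[RHS]/(fine (\prod_i p (w i))%:E).
rewrite -(iid_cylinder predT w s_inj); congr (fine (mu _)).
apply/seteqP; split => x /= xw; first by move=> i _; rewrite -xw ffunE.
by apply/ffunP => i; rewrite ffunE xw.
Qed.

(** Events given by finite lists of constraints are stable under intersection and generate the
    sigma-algebra, so it suffices to compare the two measures on them. *)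
Lemma iid_shift_invariant (u : site d) (S : set Omega) : measurable S ->
  mu (Defs.shift u @^-1` S) = mu S.
Proof.
pose C := [set C : set Omega | exists r : seq (site d * A),
  C = [set x | forall va, va \in r -> x va.1 = va.2]].
have mC : @measurable _ Omega = <<s C >>.
  apply/seteqP; split; apply: smallest_sub => //.
  - move=> _ [v [a ->]]; apply: sub_sigma_algebra; exists [:: (v, a)].
    apply/seteqP; split => x /= => [xva va|xr]; first by rewrite inE => /eqP ->.
    exact: xr (v, a) (mem_head _ _).
  - exact: sigma_algebra_measurable.
  - move=> _ [r ->]; elim: r => [|va r IHr].
      by rewrite (_ : [set x | _] = setT) //; apply/seteqP; split.
    have := measurableI _ _ (measurable_coord va.1 va.2) IHr.
    congr (measurable _); apply/seteqP; split => x /=.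
      by move=> [xva xr] vb; rewrite inE => /predU1P[->//|/xr].
    by move=> xr; split => [|vb vbr]; apply: xr; rewrite inE ?eqxx ?vbr ?orbT.
move=> mS.
pose nu := pushforward mu (Defs.shift u : Omega -> Omega).
apply: (measure_unique C (fun=> setT) mC _ _ _ nu mu) => //.
- move=> _ _ [r ->] [r' ->]; exists (r ++ r'); apply/seteqP; split => x /=.
    by move=> [xr xr'] va; rewrite mem_cat => /orP[/xr|/xr'].
  by move=> xr; split => va var; apply: xr; rewrite mem_cat var ?orbT.
- by move=> _; exists [::]; apply/seteqP; split.
- by rewrite bigcup_const //; exists 0%N.
- exact: measurable_shift.
- move=> ms _ [r ->]; set D := [set x | _].
  change (mu (Defs.shift u @^-1` D) = mu D); rewrite /D => {D}.
  (* A list may contradict itself, which makes the event empty. Otherwise a member [x0] supplies the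
     letters of a genuine cylinder, and repeated sites merge in [F]. *)
  have [->|/set0P[x0 x0r]] := eqVneq [set x : Omega | forall va, va \in r -> x va.1 = va.2] set0.
    by rewrite preimage_set0.
  pose F := [fset va.1 | va in r]%fset.
  pose w : {ffun F -> A} := [ffun v => x0 (val v)].
  have cyl (v0 : site d) : [set x : Omega | forall va, va \in r -> x (va.1 + v0) = va.2] =
      [set x | restr (fun v : F => val v + v0) x = w].
    apply/seteqP; split => x /= xr.
      apply/ffunP => -[v vF]; rewrite !ffunE /=.
      by have /imfsetP[va /= var ->] := vF; rewrite xr // x0r.
    move=> va var; have vF : va.1 \in F by apply/imfsetP; exists va.
    by have /ffunP/(_ [` vF]%fset) := xr; rewrite !ffunE /= x0r.
  have lawF v0 : mu [set x | restr (fun v : F => val v + v0) x = w] = (weight p w)%:E.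
    rewrite lawE; last exact: fin_measurable_restr.
    by rewrite law_restr // => v v' /addIr /val_inj.
  transitivity (weight p w)%:E; first by rewrite -(lawF u) -cyl.
  rewrite -(lawF 0) -cyl; congr (mu _).
  by apply/seteqP; split => x /= xr va /xr; rewrite addr0.
- move=> ms _; have : (mu setT < +oo)%E by rewrite probability_setT ltry.
  exact.
Qed.

Lemma iid_ae_shift (u : site d) (Q : Omega -> Prop) :
  {ae mu, forall x, Q x} -> {ae mu, forall x, Q (Defs.shift u x)}.
Proof.
move=> [N [mN N0 QN]]; exists (Defs.shift u @^-1` N); split.
- by rewrite -[X in measurable X]setTI; exact: measurable_shift.
- by rewrite iid_shift_invariant.
- by move=> x nQ; exact: QN.
Qed.
End Iid.
End Cylinders.

Section AlmostEverywhere.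
Context {disp : measure_display} {X : measurableType disp} {R : realType}.
Variable mu : {measure set X -> \bar R}.

Lemma ae_imply2 (P Q S : X -> Prop) : (forall x, P x -> Q x -> S x) ->
  {ae mu, forall x, P x} -> {ae mu, forall x, Q x} -> {ae mu, forall x, S x}.
Proof. by move=> PQS; apply: filterS2. Qed.

Lemma ae_imply (P Q : X -> Prop) : (forall x, P x -> Q x) ->
  {ae mu, forall x, P x} -> {ae mu, forall x, Q x}.
Proof. by move=> PQ; apply: filterS. Qed.

Lemma ae_forall (I : finType) (P : I -> X -> Prop) :
  (forall i, {ae mu, forall x, P i x}) -> {ae mu, forall x, forall i, P i x}.
Proof. exact: filter_forall. Qed.
End AlmostEverywhere.

Lemma le_measure_ae (disp : measure_display) (X : measurableType disp) (R : realType)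
    (mu : {measure set X -> \bar R}) (D E : set X) :
  measurable D -> measurable E -> {ae mu, forall x, D x -> E x} ->
  (mu D <= mu E)%E.
Proof.
move=> mD mE [N [mN N0 DEN]].
apply: (@le_trans _ _ (mu (E `|` N))).
  apply: le_measure; rewrite ?inE //; first exact: measurableU.
  move=> x Dx; have [Ex|nEx] := pselect (E x); [by left|right].
  by apply: DEN => /= /(_ Dx).
by rewrite -[leRHS]adde0 -N0; exact: measureU2.
Qed.

Lemma in_boxS (d M M' : nat) (u : site d) : (M <= M')%N -> in_box M u -> in_box M' u.
Proof. by move=> MM' uM i; apply: le_trans (uM i) _; rewrite lez_nat. Qed.

(** * Values of the image determined by a finite window *)

Section Coding.
Variables (R : realType) (d : nat) (A B : finType) (a0 : A) (b0 : B).
Variables (p : A -> R) (q : B -> R).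
Variables (mu : probability (Omega d a0) R) (nu : probability (Omega d b0) R).
Hypotheses (p_prob : prob_vec p) (q_prob : prob_vec q).
Hypotheses (mu_iid : iid_measure p mu) (nu_iid : iid_measure q nu).
Variable phi : Omega d a0 -> Omega d b0.
Hypothesis phi_factor : factor_map mu nu phi.

Definition codes (M : nat) (x : Omega d a0) (b : B) :=
  {ae mu, forall a : Omega d a0,
    (forall v, in_box M v -> a v = x v) -> phi a 0 = b}.

(** If the cylinder of the box is null, every [b] qualifies and one of them is chosen. *)
Definition coded (M : nat) (x : Omega d a0) : option B :=
  if pselect (exists b, codes M x b) is left ex then Some (projT1 (cid ex)) else None.

Lemma coded_local M (x x' : Omega d a0) :
  (forall v, in_box M v -> x v = x' v) -> coded M x = coded M x'.
Proof.
move=> xx'; rewrite /coded.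
(* The choice is a function of the predicate, so equality of the predicates makes both choices agree
   even when the code is not unique. *)
suff -> : codes M x = codes M x' by [].
apply/funext => b; congr almost_everywhere; apply/funext => a.
rewrite propeqE; split => + ax; apply => v vM; rewrite ax ?xx' //.
Qed.

Lemma coded_codes M x b : coded M x = Some b -> codes M x b.
Proof. by rewrite /coded; case: pselect => // ex [<-]; case: cid. Qed.

Lemma coded_none_radius M x : coded M x = None ->
  (M%:R%:E <= coding_radius mu phi x)%E.
Proof.
rewrite /coded; case: pselect => // nex _.
apply: le_ereal_inf_tmp => _ [n /= xn <-]; rewrite lee_fin ler_nat leqNgt.
apply/negP => nM; apply: nex; exists (phi x 0).
apply: ae_imply xn => a xa ax; apply: xa => v vn; apply: ax.
exact: in_boxS (ltnW nM) vn.
Qed.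

Lemma coded_shift M (v : site d) (x0 : Omega d a0) b :
  coded M (Defs.shift v x0) = Some b ->
  {ae mu, forall x : Omega d a0,
    (forall u, in_box M u -> x (u + v) = x0 (u + v)) -> phi x v = b}.
Proof.
move=> /coded_codes /(iid_ae_shift mu_iid v) codev.
have [_ /(_ v) phiv _] := phi_factor.
apply: ae_imply2 phiv codev => x -> xv xx0.
by rewrite -[v]add0r; apply: xv => u uM; exact: xx0.
Qed.

(* An uncoded site puts no constraint on the image, hence has weight 1. *)
Definition coded_weight (o : option B) : R := if o is Some b then q b else 1.

Lemma measurable_cylinder (A' : finType) (c0 : A') (I : finType) (Q : pred I)
    (s : I -> site d) (w : I -> A') :
  measurable [set x : Omega d c0 | forall i, Q i -> x (s i) = w i].
Proof.
rewrite (_ : [set x | _] =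
    [set x | [forall i, Q i ==> (restr s x i == w i)]]); last first.
  apply/seteqP; split => x /=.
    by move=> xw; apply/forallP => i; apply/implyP => Qi; rewrite ffunE xw.
  by move=> /forallP xw i Qi; have /implyP/(_ Qi)/eqP := xw i; rewrite ffunE.
apply: (measurable_fin_preimage
  (fun w' : {ffun I -> A'} => [forall i, Q i ==> (w' i == w i)])).
exact: fin_measurable_restr.
Qed.

(** The left side is the [mu]-measure of the cylinder of [x0] on the sites [s]. These contain all
    the windows around the sites [t], so almost surely [phi] maps this cylinder into that of the
    coded values, whose [nu]-measure is the right side. *)
Lemma weight_le_coded_weight M (I J : finType) (s : I -> site d) (t : J -> site d)
    (x0 : Omega d a0) : injective s -> injective t ->
  (forall j u, in_box M u -> exists i, s i = u + t j) ->
  \prod_i p (x0 (s i)) <= \prod_j coded_weight (coded M (Defs.shift (t j) x0)).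
Proof.
move=> s_inj t_inj cover.
pose c j := coded M (Defs.shift (t j) x0).
(* The default [b0] is never read: only the coded [j] are constrained. *)
pose y j : B := if c j is Some b then b else b0.
have -> : \prod_j coded_weight (c j) = \prod_(j | c j) q (y j).
  rewrite [RHS]big_mkcond; apply: eq_bigr => j _; rewrite /y.
  by case: (c j).
have [mphi _ phinu] := phi_factor.
rewrite -lee_fin -(iid_cylinder mu_iid predT (fun i => x0 (s i)) s_inj).
rewrite -(iid_cylinder nu_iid c y t_inj) -phinu; last exact: measurable_cylinder.
apply: le_measure_ae.
- exact: measurable_cylinder.
- by rewrite -[X in measurable X]setTI; apply: mphi => //; exact: measurable_cylinder.
have ae_j j : {ae mu, forall x : Omega d a0,
    (forall i, x (s i) = x0 (s i)) -> c j -> phi x (t j) = y j}.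
  case cj: (c j) => [b|]; last exact: aeW.
  have := coded_shift cj; apply: ae_imply => x xb xs _.
  rewrite /y -/(c j) cj; apply: xb => u uM; have [i <-] := cover j u uM; exact: xs.
apply: ae_imply (ae_forall ae_j) => x xj xs j cj.
by apply: xj cj => i; exact: xs.
Qed.
End Coding.

(** * The discrete torus, its tilings and its blocks *)

Section Torus.
Variables (d n : nat).
Hypothesis n_gt1 : (1 < n)%N.

(* ['Z_n] is the ring of integers mod [n] only for [1 < n]. *)
Definition torus := 'rV['Z_n]_d.
Definition to_torus (v : site d) : torus := \row_i (v 0 i)%:~R.
Definition of_torus (t : torus) : site d := \row_i (t 0 i : nat)%:Z.

Lemma to_torusD u v : to_torus (u + v) = to_torus u + to_torus v.
Proof. by apply/rowP => i; rewrite !mxE rmorphD. Qed.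

Lemma of_torusK : cancel of_torus to_torus.
Proof. by move=> t; apply/rowP => i; rewrite !mxE; exact: natr_Zp. Qed.

Let Zp_period : n%:Z%:~R = 0 :> 'Z_n.
Proof. exact: pchar_Zp. Qed.

Lemma Zp_intE (z : int) : (z%:~R : 'Z_n)%:Z = (z %% n)%Z.
Proof.
have n0 : n%:Z != 0 by rewrite eqz_nat -lt0n ltnW.
have -> : z%:~R = (z %% n)%Z%:~R :> 'Z_n.
  by rewrite {1}(divz_eq z n) intrD intrM Zp_period mulr0 add0r.
have := modz_ge0 z n0; have := ltz_pmod z (ltnW n_gt1 : 0 < n%:Z).
case: (z %% n)%Z => // k; rewrite ltz_nat => kn _.
by rewrite -[k%:~R]/(k%:R) val_Zp_nat // modn_small.
Qed.

Lemma to_torusK v i : of_torus (to_torus v) 0 i = (v 0%R i %% n)%Z.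
Proof. by rewrite !mxE Zp_intE. Qed.

Lemma of_torus_lt t i : 0 <= of_torus t 0 i < n%:Z.
Proof.
rewrite mxE; apply/andP; split=> //; rewrite ltz_nat.
by rewrite -[X in (_ < X)%N](Zp_cast n_gt1).
Qed.

(* [k ^ d] adjacent translates of the fundamental cube; [c = 1] moves the corner
   so that the [(k + 2) ^ d] cubes surround the [k ^ d] ones of [c = 0]. *)
Definition tile (k c : nat) (tj : torus * 'rV['I_k]_d) : site d :=
  of_torus tj.1 + \row_i (n%:Z * ((tj.2 0 i : nat)%:Z - c%:Z)).

Lemma to_torus_tile k c (tj : torus * 'rV['I_k]_d) :
  to_torus (tile c tj) = tj.1.
Proof.
rewrite to_torusD of_torusK -[RHS]addr0; congr (_ + _); apply/rowP => i.
by rewrite !mxE intrM Zp_period mul0r.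
Qed.

Lemma tile_inj k c : injective (@tile k c).
Proof.
move=> tj tj' e; have e1 := congr1 to_torus e; rewrite !to_torus_tile in e1.
move: tj tj' e1 e => [t j] [t' j'] /= <- /addrI /rowP e; congr (_, _).
have n0 : n%:Z != 0 by rewrite eqz_nat -lt0n ltnW.
by apply/rowP => i; have := e i; rewrite !mxE => /(mulfI n0) /addIr [] /val_inj.
Qed.

(** As [M <= n], moving by [u] changes the cube by at most one in each direction. The quotients by
    [n] thus lie between [-1] and [k], and adding 1 gives an index below [k + 2]. *)
Lemma tile_cover M k (tj : torus * 'rV['I_k]_d) u : (M <= n)%N -> in_box M u ->
  exists tj' : torus * 'rV['I_k.+2]_d, tile 1 tj' = u + tile 0 tj.
Proof.
move=> Mn uM; pose v := u + tile 0 tj.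
have vn i : -1 <= (v 0%R i %/ n)%Z < k.+1%:Z.
  have := uM i; have := of_torus_lt tj.1 i; have := ltn_ord (tj.2 0 i).
  have -> : v 0 i = u ord0 i + (of_torus tj.1 0 i + n%:Z * (tj.2 0 i : nat)%:Z).
    by rewrite !mxE subr0.
  move: (u ord0 i) (of_torus _ _ _) (nat_of_ord _) => a b j jk bn aM.
  have n0 : 0 < n%:Z by rewrite ltz_nat ltnW.
  by rewrite lez_divRL // ltz_divLR //; nia.
have [z zE] : exists z : 'I_d -> int, forall i, (v 0%R i %/ n)%Z = z i by eexists.
exists (to_torus v, \row_i inord `|z i + 1|); apply/rowP => i.
rewrite -/v [RHS](divz_eq (v 0 i) n) mxE to_torusK addrC zE !mxE; congr (_ + _).
by have := vn i; rewrite zE => zk; rewrite inordK; nia.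
Qed.

Definition block (a b : nat) : {set torus} :=
  finset (fun t : torus => [forall i, (a <= t 0%R i < b)%N]).

Lemma card_torus : #|{: torus}| = (n ^ d)%N.
Proof. by rewrite card_mx mul1n card_ord Zp_cast. Qed.

Lemma card_block a b : (a <= b <= n)%N -> #|block a b| = ((b - a) ^ d)%N.
Proof.
move=> /andP[ab bn].
pose h (j : 'rV['I_(b - a)]_d) : torus := \row_i (a + j 0%R i)%N%:R.
have hE j i : (h j 0%R i = a + j 0%R i :> nat)%N.
  by rewrite mxE val_Zp_nat // modn_small //; have := ltn_ord (j 0%R i); lia.
have h_inj : injective h.
  move=> j j' e; apply/rowP => i; apply/val_inj => /=.
  have : (h j 0%R i = h j' 0%R i :> nat) by rewrite e.
  by rewrite !hE => /addnI.
rewrite -[RHS](_ : #|{: 'rV['I_(b - a)]_d}| = _); last by rewrite card_mx mul1n card_ord.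
rewrite -(card_imset predT h_inj); apply: eq_card => t; rewrite inE.
apply/forallP/imsetP => [tab|[j _ ->] i]; last first.
  by rewrite hE; have := ltn_ord (j 0%R i); move: (nat_of_ord _) => m mb; lia.
have tlt i : (t 0%R i - a < b - a)%N by have := tab i; move: (nat_of_ord _) => m; lia.
exists (\row_i Ordinal (tlt i)) => //; apply/rowP => i; apply/val_inj => /=.
by rewrite hE mxE /= subnKC //; case/andP: (tab i).
Qed.

(** The margins of width [M] keep [u + of_torus t] in the fundamental cube, so that reduction modulo
    [n] does nothing. *)
Lemma block_shift M a b t u : (M <= a)%N -> (b + M <= n)%N -> t \in block a b ->
  in_box M u ->
  of_torus (to_torus u + t) = u + of_torus t /\
  to_torus u + t \in block (a - M) (b + M).
Proof.
move=> Ma bM; rewrite inE => /forallP tab uM.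
have E i : of_torus (to_torus u + t) 0 i = u 0 i + (t 0 i : nat)%:Z.
  rewrite -{1}[t]of_torusK -to_torusD to_torusK !mxE modz_small //.
  have := tab i; have : `|u 0 i| <= M%:Z := uM i.
  by move: (u 0 i) (nat_of_ord _) => x y; lia.
split; first by apply/rowP => i; rewrite E !mxE.
rewrite inE; apply/forallP => i.
have := E i; rewrite [in LHS]mxE; have := tab i; have : `|u 0 i| <= M%:Z := uM i.
by move: (u 0 i) (nat_of_ord _) (nat_of_ord _) => x y z; lia.
Qed.

Lemma block_shift_notin M a b t u : (M <= a)%N -> (b + M <= n)%N ->
  t \notin block (a - M) (b + M) -> in_box M u -> to_torus u + t \notin block a b.
Proof.
move=> Ma bM tab uM; apply: contra tab => sab.
have uM' : in_box M (- u) by move=> i; rewrite mxE normrN.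
have [_] := block_shift Ma bM sab uM'.
rewrite addrA -to_torusD addNr.
suff -> : to_torus 0 = 0 by rewrite add0r.
by apply/rowP => i; rewrite !mxE.
Qed.
End Torus.

Lemma le_of_archi (R : archiRealFieldType) (x y C : R) :
  (forall k, x <= y + C / k.+1%:R) -> x <= y.
Proof.
move=> xy; rewrite leNgt; apply/negP => yx.
have C0 : 0 < C by have := xy 0%N; rewrite divr1; lra.
have := archi_boundP (ltW (divr_gt0 C0 (_ : 0 < x - y))).
rewrite subr_gt0 => /(_ yx); set k := Num.bound _ => Ck.
have := xy k; rewrite leNgt => /negP; apply.
rewrite -ltrBrDl ltr_pdivrMr // mulrC -ltr_pdivrMr ?subr_gt0 //.
by apply: lt_le_trans Ck _; rewrite ler_nat.
Qed.

(** With [N = k + 2], Bernoulli's inequality bounds [(k / N) ^ d] below by [1 - 2 * d / N]; hence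
    [x - y <= 2 * d * x / N], which tends to zero. *)
Lemma le_of_volume_ratio (R : archiRealFieldType) (d k0 : nat) (x y : R) : 0 <= x ->
  (forall k, (k0 <= k)%N -> k%:R ^+ d * x <= k.+2%:R ^+ d * y) -> x <= y.
Proof.
move=> x0 xy; apply: (@le_of_archi _ _ _ (2 * d%:R * x)) => m.
pose k := (k0 + m)%N; pose N : R := k.+2%:R.
have N2 : 2 <= N by rewrite ler_nat.
have N0 : 0 < N by lra.
have bernoulli e : N ^+ e * (N - 2 * e%:R) <= (N - 2) ^+ e * N.
  elim: e => [|e IHe]; first by rewrite !expr0; lra.
  rewrite [(N - 2) ^+ _]exprS -mulrA; apply: (@le_trans _ _ ((N - 2) * (N ^+ e * (N - 2 * e%:R)))).
    rewrite [leRHS]mulrCA exprSr -mulrA ler_wpM2l ?exprn_ge0 ?(ltW N0) //.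
    by rewrite -[e.+1%:R]natr1; have := ler0n R e; nra.
  by rewrite ler_wpM2l // subr_ge0.
have kN : k%:R = N - 2 by rewrite /N -[k.+2]addn2 natrD addrK.
have := xy k (leq_addr _ _); rewrite -/N kN => H.
have : N ^+ d * (N - 2 * d%:R) * x <= N ^+ d * (N * y).
  apply: (@le_trans _ _ ((N - 2) ^+ d * N * x)); first by rewrite ler_wpM2r.
  by rewrite [N * y]mulrC mulrA mulrAC ler_wpM2r // ltW.
rewrite -mulrA ler_pM2l ?exprn_gt0 // => {}H.
have mN : m.+1%:R <= N by rewrite ler_nat /k; lia.
have xyN : x - y <= 2 * d%:R * x / N by rewrite ler_pdivlMr //; nra.
rewrite -lerBlDl; apply: le_trans xyN _.
by rewrite ler_wpM2l ?mulr_ge0 // lef_pV2 ?posrE.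
Qed.

(** * The pointwise information inequality for periodic configurations *)

Section Periodic.
Variables (R : realType) (d : nat) (A B : finType) (a0 : A) (b0 : B).
Variables (p : A -> R) (q : B -> R).
Variables (mu : probability (Omega d a0) R) (nu : probability (Omega d b0) R).
Hypotheses (p_prob : prob_vec p) (q_prob : prob_vec q).
Hypotheses (mu_iid : iid_measure p mu) (nu_iid : iid_measure q nu).
Variable phi : Omega d a0 -> Omega d b0.
Hypothesis phi_factor : factor_map mu nu phi.
Variables (n M : nat).
Hypotheses (n_gt1 : (1 < n)%N) (Mn : (M <= n)%N).
Local Notation T := (torus d n).

Definition periodic_config (w : {ffun T -> A}) (t : T) : Omega d a0 :=
  fun u => w (to_torus n u + t).

Definition torus_coded (t : T) (w : {ffun T -> A}) : option B :=
  coded mu phi M (periodic_config w t).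

Lemma periodic_shift (w : {ffun T -> A}) v :
  Defs.shift v (periodic_config w 0) = periodic_config w (to_torus n v).
Proof.
by apply/funext => u; rewrite /Defs.shift /periodic_config addr0 to_torusD.
Qed.

(** The cylinder inequality for the periodic extension of [w]: the windows around [k ^ d] period
    cubes are covered by the surrounding [(k + 2) ^ d] cubes, and each cube repeats the same
    product. *)
Lemma weight_power_le (w : {ffun T -> A}) k :
  weight p w ^+ (k.+2 ^ d) <=
  (\prod_t coded_weight q (torus_coded t w)) ^+ (k ^ d).
Proof.
have := weight_le_coded_weight mu_iid nu_iid phi_factor (M := M)
  (periodic_config w 0) (@tile_inj d n n_gt1 k.+2 1) (@tile_inj d n n_gt1 k 0).
rewrite (eq_bigr (fun tj : T * 'rV['I_k.+2]_d => p (w tj.1))); last first.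
  by move=> tj _; rewrite /periodic_config addr0 to_torus_tile.
rewrite [leRHS](eq_bigr (fun tj : T * 'rV['I_k]_d =>
    coded_weight q (torus_coded tj.1 w))); last first.
  by move=> tj _; rewrite periodic_shift to_torus_tile.
rewrite -(pair_bigA _ (fun t (_ : 'rV['I_k.+2]_d) => p (w t))) /=.
rewrite -(pair_bigA _ (fun t (_ : 'rV['I_k]_d) => coded_weight q (torus_coded t w))) /=.
under eq_bigr do rewrite prodr_const card_mx mul1n card_ord.
under [leRHS]eq_bigr do rewrite prodr_const card_mx mul1n card_ord.
rewrite !prodrXl; apply => j u uM; exact: (tile_cover n_gt1 j Mn uM).
Qed.

Definition coded_info (o : option B) : R := if o is Some b then info q b else 0.

(** Take logarithms in [weight_power_le] and let [k] grow: the ratio of the two exponents tends to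
    1. *)
Lemma coded_info_sum_le (w : {ffun T -> A}) : 0 < weight p w ->
  0 <= \sum_t (info p (w t) - coded_info (torus_coded t w)).
Proof.
move=> w0; set Q := \prod_t coded_weight q (torus_coded t w).
have [p0 p1] := p_prob; have [q0 q1] := q_prob.
have Q0 : 0 < Q.
  (* For [k = 1] the exponent on the right is 1, so [Q] dominates a positive number. *)
  have := weight_power_le w 1; rewrite exp1n expr1; apply: lt_le_trans.
  exact: exprn_gt0.
have cw_ge0 t : 0 <= coded_weight q (torus_coded t w).
  by rewrite /coded_weight; case: (torus_coded t w).
have cw_gt0 t : 0 < coded_weight q (torus_coded t w).
  rewrite lt_def cw_ge0 andbT; apply/eqP => e.
  by move: Q0; rewrite /Q (bigD1 t) //= e mul0r ltxx.
have pw_gt0 t : 0 < p (w t).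
  rewrite lt_def p0 andbT; apply/eqP => e.
  by move: w0; rewrite /weight (bigD1 t) //= e mul0r ltxx.
have ln_prod (F : T -> R) : (forall t, 0 < F t) -> ln (\prod_t F t) = \sum_t ln (F t).
  move=> F0; suff [] : 0 < \prod_t F t /\ ln (\prod_t F t) = \sum_t ln (F t) by [].
  elim/big_rec2: _ => [|t x y _ [y0 <-]]; first by rewrite ln1.
  by rewrite mulr_gt0 // lnM ?posrE.
have -> : \sum_t (info p (w t) - coded_info (torus_coded t w)) = ln Q - ln (weight p w).
  rewrite !ln_prod // -sumrB; apply: eq_bigr => t _.
  rewrite /info lnV ?posrE // addrC; congr (_ - _).
  have := cw_gt0 t; rewrite /coded_info /coded_weight.
  by case: (torus_coded t w) => [b qb|]; rewrite ?ln1 ?oppr0 // /info lnV ?opprK.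
rewrite subr_ge0 -lerN2; apply: (@le_of_volume_ratio _ d 0).
  rewrite oppr_ge0 ln_prod //; apply: sumr_le0 => t _; rewrite ln_le0 //.
  rewrite /coded_weight; case: (torus_coded t w) => // b.
  by rewrite -q1 (bigD1 b) //= lerDl sumr_ge0.
move=> k _; rewrite !mulrN lerN2 -!natrX !mulr_natl -!lnXn //.
by rewrite ler_ln ?posrE ?exprn_gt0 //; exact: weight_power_le.
Qed.
End Periodic.

Lemma sum_info (R : realType) (A : finType) (p : A -> R) : prob_vec p ->
  \sum_a p a * info p a = entropy p.
Proof.
move=> [p0 _]; rewrite /entropy -sumrN; apply: eq_bigr => a _.
have := p0 a; rewrite le_eqVlt => /predU1P[<-|pa]; first by rewrite !mul0r oppr0.
by rewrite /info lnV ?posrE // mulrN.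
Qed.

Lemma sum_centered_info (R : realType) (A : finType) (p : A -> R) : prob_vec p ->
  \sum_a p a * (info p a - entropy p) = 0.
Proof.
move=> pp; have [_ p1] := pp; under eq_bigr do rewrite mulrBr.
by rewrite sumrB sum_info // -mulr_suml p1 mul1r subrr.
Qed.

Lemma info_ge0 (R : realType) (A : finType) (p : A -> R) a : prob_vec p ->
  0 <= info p a.
Proof.
move=> [p0 p1]; have := p0 a; rewrite le_eqVlt => /predU1P[pa|pa].
  (* A letter of probability zero has information zero by the conventions for inverse and logarithm
     at 0. *)
  by rewrite /info -pa invr0 ln0.
rewrite /info lnV ?posrE // oppr_ge0 ln_le0 // -p1 (bigD1 a) //= lerDl.
exact: sumr_ge0.
Qed.

(** One constant dominating both centred informations and [info q], sums of absolute values standing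
    in for maxima. Centring both by [entropy p] suits the case of equal entropies. *)
Definition info_scale (R : realType) (A B : finType) (p : A -> R) (q : B -> R) : R :=
  \sum_a `|info p a - entropy p| + \sum_b `|info q b - entropy p| +
  \sum_b `|info q b|.

Lemma mean_translate (R : realFieldType) (T : finZmodType) (A : finType) (p : A -> R)
    (t : T) (g : {ffun T -> A} -> R) :
  mean (weight p) (fun w => g [ffun s => w (s + t)]) = mean (weight p) g.
Proof.
pose h (t : T) (w : {ffun T -> A}) : {ffun T -> A} := [ffun s => w (s + t)].
have hK u : cancel (h u) (h (- u)).
  by move=> w; apply/ffunP => s; rewrite !ffunE subrK.
rewrite /mean [RHS](reindex (h t)) /=; last first.
  exists (h (- t)) => w _; first exact: hK.
  by have := hK (- t) w; rewrite opprK.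
apply: eq_bigr => w _; congr (_ * _); rewrite /weight.
rewrite (reindex_inj (addIr t)) /=.
by apply: eq_bigr => s _; rewrite ffunE.
Qed.

Lemma le_rescale (R : realFieldType) (D a b x y z : R) : 0 < D ->
  a / D * x <= b / D * y + z -> a * x <= b * y + D * z.
Proof.
move=> D0; rewrite -(ler_pM2l D0); congr (_ <= _); field; exact: lt0r_neq0.
Qed.

(** * Transfer between the torus and the lattice *)

Section TorusComparison.
Variables (R : realType) (d : nat) (A B : finType) (a0 : A) (b0 : B).
Variables (p : A -> R) (q : B -> R).
Variables (mu : probability (Omega d a0) R) (nu : probability (Omega d b0) R).
Hypotheses (p_prob : prob_vec p) (q_prob : prob_vec q).
Hypotheses (mu_iid : iid_measure p mu) (nu_iid : iid_measure q nu).
Variable phi : Omega d a0 -> Omega d b0.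
Hypothesis phi_factor : factor_map mu nu phi.
Variables (n M : nat).
Hypothesis n_gt1 : (1 < n)%N.
Local Notation T := (torus d n).
Local Notation torus_coded := (torus_coded mu phi M).

(** The sites whose window of radius [M] does not wrap around, so that torus and lattice agree on
    it. *)
Definition inner : {set T} := block d n M (n - M).

Lemma inner_shift t u : t \in inner -> in_box M u ->
  of_torus (to_torus n u + t) = u + of_torus t.
Proof.
rewrite /inner; have [nM|Mn tM uM] := ltnP n M; last first.
  by have [] := block_shift n_gt1 (leqnn M) (_ : n - M + M <= n)%N tM uM; rewrite ?subnK.
rewrite inE => /forallP tM _; apply/rowP => i; have := tM i.
(* Truncated subtraction leaves no admissible coordinate in this case. *)
have -> : (n - M = 0)%N by lia.
by rewrite ltn0 andbF.
Qed.

Lemma periodic_restr x t u : t \in inner -> in_box M u ->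
  periodic_config a0 (restr (@of_torus d n) x) t u = Defs.shift (of_torus t) x u.
Proof. by move=> tM uM; rewrite /periodic_config /restr ffunE inner_shift. Qed.

Lemma torus_coded_restr x t : t \in inner ->
  torus_coded t (restr (@of_torus d n) x) = coded mu phi M (Defs.shift (of_torus t) x).
Proof. by move=> tM; apply: coded_local => u; exact: periodic_restr. Qed.

Definition uncoded : set (Omega d a0) := [set x | coded mu phi M x = None].

(** [coded] is defined by choice but reads only the window, so the uncoded event is a shift of an
    event about finitely many coordinates. This yields its measurability and its measure
    together. *)
Lemma uncoded_torus t : t \in inner ->
  measurable uncoded /\
  mu uncoded = (mean (weight p) (fun w => (torus_coded t w == None)%:R))%:E.
Proof.
move=> tM; pose E := [set x : Omega d a0 | torus_coded t (restr (@of_torus d n) x) == None].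
have of_inj : injective (@of_torus d n) by apply: can_inj (@of_torusK d n).
have mE : measurable E.
  apply: (measurable_fin_preimage (fun w : {ffun T -> A} => torus_coded t w == None)).
  exact: fin_measurable_restr.
have uncodedE : uncoded = Defs.shift (- of_torus t) @^-1` E.
  apply/seteqP; split => x /=; rewrite /E /uncoded /= torus_coded_restr //.
    move=> xN; apply/eqP; rewrite -xN; apply: coded_local => u _.
    by rewrite /Defs.shift addrK.
  move=> /eqP <-; apply: coded_local => u _.
  by rewrite /Defs.shift addrK.
split.
  by rewrite uncodedE -[X in measurable X]setTI; exact: measurable_shift.
rewrite uncodedE (iid_shift_invariant mu_iid) //.
rewrite (measure_fin_preimage _ (fun w : {ffun T -> A} => torus_coded t w == None)); last first.
  exact: fin_measurable_restr.
congr EFin; rewrite /mean [LHS]big_mkcond; apply: eq_bigr => w _.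
by rewrite (law_restr mu_iid of_inj); case: ifP; rewrite ?mulr1 ?mulr0.
Qed.

Definition joint (x : Omega d a0) : {ffun T -> A} * {ffun T -> B} :=
  (restr (@of_torus d n) x, restr (@of_torus d n) (phi x)).

Lemma fin_measurable_joint : fin_measurable joint.
Proof.
apply: fin_measurable_pair; first exact: fin_measurable_restr.
move=> w; have [mphi _ _] := phi_factor.
have := mphi measurableT _ (@fin_measurable_restr d B b0 _ (@of_torus d n) w).
by rewrite setTI.
Qed.

Lemma mean_joint_fst f :
  mean (law mu joint) (fun o => f o.1) = mean (weight p) f.
Proof.
rewrite -(mean_law_comp mu fst f fin_measurable_joint); apply: eq_bigr => w _.
by rewrite -(law_restr mu_iid (can_inj (@of_torusK d n))).
Qed.

Lemma mean_joint_snd f :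
  mean (law mu joint) (fun o => f o.2) = mean (weight q) f.
Proof.
rewrite -(mean_law_comp mu snd f fin_measurable_joint); apply: eq_bigr => w _.
rewrite -(law_restr nu_iid (can_inj (@of_torusK d n))) /law.
have [_ _ phinu] := phi_factor; rewrite -phinu //.
exact: fin_measurable_restr.
Qed.

(** By [coded_shift], applied to the periodic extension of [o.1], a pair [o] violating the
    conclusion is almost surely not attained, hence has weight zero. *)
Lemma joint_coded o t b : t \in inner -> 0 < law mu joint o ->
  torus_coded t o.1 = Some b -> o.2 t = b.
Proof.
move=> tM o0 tb; apply/eqP; apply: contraTT o0 => ob; rewrite -leNgt.
suff : (mu [set x | joint x = o] <= mu set0)%E.
  by rewrite measure0 (lawE mu o fin_measurable_joint) lee_fin.
apply: le_measure_ae => //; first exact: fin_measurable_joint.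
have := @coded_shift _ _ _ _ _ _ _ _ _ mu_iid _ phi_factor M (of_torus t)
  (periodic_config a0 o.1 0) b.
rewrite periodic_shift of_torusK // => /(_ tb).
apply: ae_imply => x xb xo; move: ob; rewrite -xo /= ffunE => /eqP; apply; apply: xb.
move=> u uM; rewrite -xo /periodic_config /= addr0 to_torusD of_torusK //.
by rewrite ffunE inner_shift.
Qed.

Hypothesis entropy_eq : entropy p = entropy q.

Let ca a := info p a - entropy p.
Let cb b := info q b - entropy p.
Let zeta (t : T) (w : {ffun T -> A}) := coded_info q (torus_coded t w) - entropy p.
Let K := info_scale p q.
Let kappa := K * fine (mu uncoded).

Let ca_bound a : `|ca a| <= K.
Proof.
rewrite /K /info_scale (bigD1 a) //= -!addrA lerDl.
by rewrite !addr_ge0 ?sumr_ge0.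
Qed.

Let cb_bound b : `|cb b| <= K.
Proof.
rewrite /K /info_scale [X in _ + X + _](bigD1 b) //= addrAC addrCA lerDl.
by rewrite !addr_ge0 ?sumr_ge0.
Qed.

Let info_bound b : info q b <= K.
Proof.
apply: le_trans (ler_norm _) _.
rewrite /K /info_scale [X in _ + X](bigD1 b) //= addrCA lerDl.
by rewrite !addr_ge0 ?sumr_ge0.
Qed.

Let info_ge0 b : 0 <= info q b := info_ge0 b q_prob.

(** Near the faces of the cube [torus_coded] is not related to [phi], but by translation invariance
    the mean is the same at all sites. At the inner site [t0] it is the mean of the error, which is
    zero on coded pairs and between 0 and [K] on uncoded ones. *)
Let f_mean (t0 t : T) : t0 \in inner ->
  0 <= mean (weight p) (fun w => ca (w t) - zeta t w) <= kappa.
Proof.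
move=> t0M; have [p0 p1] := p_prob; have [q0 q1] := q_prob.
have ca0 : \sum_a p a * ca a = 0 by exact: sum_centered_info.
have cb0 : \sum_b q b * cb b = 0 by rewrite /cb entropy_eq; exact: sum_centered_info.
have trans t' : mean (weight p) (fun w => ca (w t') - zeta t' w) =
    mean (weight p) (fun w => ca (w 0) - zeta 0 w).
  rewrite -(mean_translate _ t' (fun w => ca (w 0) - zeta 0 w)); apply: eq_mean => w.
  rewrite ffunE add0r; congr (_ - (coded_info _ _ - _)).
  by apply: coded_local => u _; rewrite /periodic_config ffunE addr0.
rewrite trans -(trans t0).
rewrite -(mean_error p1 q1 ca0 cb0 mean_joint_fst mean_joint_snd).
have [_ muE] := uncoded_torus t0M.
apply/andP; split.
  apply: mean_ge0; first by move=> o; exact: law_ge0.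
  move=> o o0; rewrite /cb /zeta opprB addrA subrK subr_ge0.
  case e: (torus_coded t0 o.1) => [b|] /=; last exact: info_ge0.
  by rewrite (joint_coded t0M o0 e).
rewrite /kappa muE /= -meanZ -mean_joint_fst.
apply: ler_mean; first by move=> o; exact: law_ge0.
move=> o o0; rewrite /cb /zeta opprB addrA subrK.
case e: (torus_coded t0 o.1) => [b|] /=.
  by rewrite (joint_coded t0M o0 e) subrr mulr0.
by rewrite subr0 mulr1; exact: info_bound.
Qed.

Variables (l : nat).
Hypotheses (M_gt0 : (0 < M)%N) (n_def : n = (l.+4.+4 * M)%N).
(* Three enlargements of [U] by [M] still fit in the fundamental cube, so that no
   coding window around a site of [W'] wraps around the torus. *)
Let b1 := (4 * M)%N.
Let b2 := (l.+4 * M)%N.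
Let U : {set T} := block d n b1 b2.
Let W : {set T} := block d n (b1 - M) (b2 + M).
Let W' : {set T} := block d n (b1 - M - M) (b2 + M + M).

Let blockS (x y x' y' : nat) : (x' <= x)%N -> (y <= y')%N ->
  block d n x y \subset block d n x' y'.
Proof.
move=> xx' yy'; apply/fintype.subsetP => t; rewrite !inE => /forallP tb.
by apply/forallP => i; have /andP[h1 h2] := tb i; apply/andP; split; lia.
Qed.

Let W'_inner t : t \in W' -> t \in inner.
Proof. by apply/fintype.subsetP/blockS; rewrite /b1 /b2 ?n_def; lia. Qed.

Let f_sum_ge0 w : 0 < weight p w -> 0 <= \sum_t (ca (w t) - zeta t w).
Proof.
have Mn : (M <= n)%N by rewrite n_def; lia.
move=> w0; have := coded_info_sum_le p_prob q_prob mu_iid nu_iid phi_factor n_gt1 Mn w0.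
by congr (_ <= _); apply: eq_bigr => t _; rewrite /ca /zeta opprB addrA subrK.
Qed.

Let e_ge0 t o : t \in W' -> 0 < law mu joint o -> 0 <= cb (o.2 t) - zeta t o.1.
Proof.
move=> /W'_inner tM o0; rewrite /cb /zeta opprB addrA subrK subr_ge0.
case e: (torus_coded t o.1) => [b|] /=; last exact: info_ge0.
by rewrite (joint_coded tM o0 e).
Qed.

(** The window around a site outside [W'] misses [W], since [W'] is [W] enlarged by [M]. *)
Let f_outer t : t \notin W' -> depends_on (~: W) (fun w => ca (w t) - zeta t w).
Proof.
move=> tW' w w' ww'.
have tW u : in_box M u -> to_torus n u + t \in ~: W.
  move=> uM; rewrite inE; apply: block_shift_notin tW' uM => //;
  by rewrite ?n_def /b1 /b2; lia.
have -> : w t = w' t.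
  have u0 : in_box M (0 : site d) by move=> i; rewrite mxE normr0.
  have := ww' _ (tW 0 u0); rewrite (_ : to_torus n 0 = 0) ?add0r //.
  by apply/rowP => i; rewrite !mxE.
rewrite /zeta (_ : torus_coded t w = torus_coded t w') //.
by apply: coded_local => u uM; rewrite /periodic_config ww' // tW.
Qed.

Let zeta_inner t : t \in U -> depends_on W (zeta t).
Proof.
move=> tU w w' ww'; rewrite /zeta (_ : torus_coded t w = torus_coded t w') //.
apply: coded_local => u uM; rewrite /periodic_config ww' //.
have h1 : (M <= b1)%N by rewrite /b1; lia.
have h2 : (b2 + M <= n)%N by rewrite /b2 n_def; lia.
by have [] := block_shift n_gt1 h1 h2 tU uM.
Qed.

Let W'_nonempty : exists t, t \in W'.
Proof.
apply/set0Pn; rewrite -card_gt0 card_block // /b1 /b2 ?n_def.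
  by rewrite expn_gt0; apply/orP; left; lia.
by lia.
Qed.

Let s2p := \sum_a p a * (info p a - entropy p) ^+ 2.
Let s2q := \sum_b q b * (info q b - entropy q) ^+ 2.
Let rho := Num.sqrt (n ^ d)%:R : R.

Let rho_gt0 : 0 < rho.
Proof. by rewrite sqrtr_gt0 ltr0n expn_gt0 ltnW. Qed.

Let rho_sqr : rho ^+ 2 = #|{: T}|%:R.
Proof. by rewrite sqr_sqrtr ?ler0n // card_torus. Qed.

Lemma torus_variance_le (L : R) : 1 <= L ->
  l.+2%:R ^+ d * s2p <= l.+4%:R ^+ d * s2q +
    l.+4.+4%:R ^+ d * (6 * K ^+ 4 / L ^+ 2 + 4 * L * (rho * kappa)) /\
  l%:R ^+ d * s2q <= l.+2%:R ^+ d * s2p +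
    l.+4.+4%:R ^+ d * (6 * K ^+ 4 / L ^+ 2 + K ^+ 2 / L +
      2 * (L ^+ 2 + 3 * L) * (rho * kappa)).
Proof.
move=> L1; have [p0 p1] := p_prob; have [q0 q1] := q_prob.
have ca0 : \sum_a p a * ca a = 0 by exact: sum_centered_info.
have cb0 : \sum_b q b * cb b = 0 by rewrite /cb entropy_eq; exact: sum_centered_info.
have [t0 /W'_inner t0M] := W'_nonempty.
have P0 o : 0 <= law mu joint o by exact: law_ge0.
have UW' : U \subset W' by apply: blockS; lia.
have WW' : W \subset W' by apply: blockS; lia.
have H1 := variance_le_image p0 p1 q0 q1 ca0 cb0 ca_bound cb_bound P0
  mean_joint_fst mean_joint_snd WW' f_sum_ge0 (fun t => f_mean t t0M) e_ge0 f_outer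
  rho_gt0 rho_sqr L1.
have H2 := image_variance_le p0 p1 q0 q1 ca0 cb0 ca_bound cb_bound P0
  mean_joint_fst mean_joint_snd UW' WW' f_sum_ge0 (fun t => f_mean t t0M) e_ge0 f_outer
  zeta_inner rho_gt0 rho_sqr L1.
have M0 : M%:R ^+ d != 0 :> R by rewrite expf_neq0 // pnatr_eq0 -lt0n.
have l8 : 0 < l.+4.+4%:R ^+ d :> R by rewrite exprn_gt0.
(* In units of [M] the sides of [U], [W], [W'] and the torus are [l], [l + 2], [l + 4] and [l + 8];
   the factor [M ^ d] cancels. *)
have cardE (x y k : nat) : (x <= y <= n)%N -> (y - x = k * M)%N ->
    #|block d n x y|%:R / #|{: T}|%:R = k%:R ^+ d / l.+4.+4%:R ^+ d :> R.
  move=> xy yx; rewrite card_block // yx card_torus // n_def !natrX !natrM !exprMn.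
  by rewrite -mulf_div divff // mulr1.
have s2qE : \sum_b q b * cb b ^+ 2 = s2q by rewrite /cb entropy_eq.
move: H1 H2; rewrite s2qE -/s2p.
have eU : #|U|%:R / #|{: T}|%:R = l%:R ^+ d / l.+4.+4%:R ^+ d :> R.
  by apply: cardE; rewrite ?n_def /b1 /b2; lia.
have eW : #|W|%:R / #|{: T}|%:R = l.+2%:R ^+ d / l.+4.+4%:R ^+ d :> R.
  by apply: cardE; rewrite ?n_def /b1 /b2; lia.
have eW' : #|W'|%:R / #|{: T}|%:R = l.+4%:R ^+ d / l.+4.+4%:R ^+ d :> R.
  by apply: cardE; rewrite ?n_def /b1 /b2; lia.
rewrite eU eW eW'.
rewrite -!addrA => /(le_rescale l8) H1 /(le_rescale l8) H2.
by split; rewrite // -!addrA.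
Qed.
End TorusComparison.

(** * The tail of the coding radius *)

(** The integral of a nonnegative function is a supremum over the simple functions below it, so
    monotonicity holds without measurability; the coding radius is handled in this way. *)
Lemma ge0_le_integral_nomeas (disp : measure_display) (X : measurableType disp)
    (R : realType) (mu : {measure set X -> \bar R}) (f g : X -> \bar R) :
  (forall x, 0 <= f x)%E -> (forall x, f x <= g x)%E ->
  (\int[mu]_x f x <= \int[mu]_x g x)%E.
Proof.
move=> f0 fg; have g0 x : (0 <= g x)%E := le_trans (f0 x) (fg x).
rewrite !ge0_integralTE //; apply: ge_ereal_sup => _ [h /= hf <-].
by apply: ereal_sup_ubound; exists h => //= x; apply: le_trans (hf x) (fg x).
Qed.

(** As [c >= 2], the terms before index [j] add up to at most [c ^+ j]. The sum is therefore at most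
    twice its last nonzero term. *)
Lemma sum_geometric_le (R : realFieldType) (c r : R) (b : nat -> bool) J :
  2 <= c -> 0 <= r -> (forall j, b j -> c ^+ j <= r) ->
  \sum_(j < J) c ^+ j * (b j)%:R <= 2 * r.
Proof.
move=> c2 r0 br; have c0 : 0 <= c by lra.
have geom k : \sum_(j < k) c ^+ j * (b j)%:R <= c ^+ k.
  elim: k => [|k IHk]; first by rewrite big_ord0 expr0.
  rewrite big_ord_recr exprS /=; have := exprn_ge0 k c0.
  have := ler_wpM2r (exprn_ge0 k c0) c2.
  by case: (b k); rewrite ?mulr1 ?mulr0; lra.
elim: J => [|J IHJ]; first by rewrite big_ord0 mulr_ge0.
rewrite big_ord_recr /=; case bJ: (b J); last by rewrite mulr0 addr0.
by rewrite mulr1; have := geom J; have := br J bJ; lra.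
Qed.

Section Tail.
Variables (R : realType) (d : nat) (A B : finType) (a0 : A) (b0 : B).
Variables (p : A -> R) (mu : probability (Omega d a0) R).
Hypothesis mu_iid : iid_measure p mu.
Variable phi : Omega d a0 -> Omega d b0.

Lemma measurable_uncoded M : (0 < M)%N -> measurable (uncoded mu phi M).
Proof.
move=> M0; have n_gt1 : (1 < 4 * M)%N by lia.
have /set0Pn[t tM] : inner d (4 * M) M != finset.set0.
  by rewrite -card_gt0 card_block // ?expn_gt0; [apply/orP; left|]; lia.
by have [] := uncoded_torus mu_iid phi n_gt1 tM.
Qed.

Lemma coding_radius_ge0 x : (0 <= coding_radius mu phi x)%E.
Proof. by apply: le_ereal_inf_tmp => _ [n _ <-]; rewrite lee_fin. Qed.

Lemma uncoded_radius_power j x : uncoded mu phi (4 ^ j) x ->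
  (((2 ^ d)%:R ^+ j)%:E <= coding_radius mu phi x `^ (d%:R / 2))%E.
Proof.
move=> /coded_none_radius rx.
have -> : (2 ^ d)%:R ^+ j = ((4 ^ j)%:R : R) `^ (d%:R / 2).
  have -> : (4 ^ j)%:R = (2 ^+ j) `^ 2 :> R.
    by rewrite powR_mulrn ?exprn_ge0 // -exprM mulnC exprM natrX; congr (_ ^+ _); ring.
  by rewrite -powRrM mulrC divfK // powR_mulrn ?exprn_ge0 // natrX -!exprM mulnC.
rewrite -poweR_EFin; apply: gt0_ler_poweR => //; rewrite in_itv /= ?leey ?andbT ?lee_fin //.
exact: coding_radius_ge0.
Qed.

(* The boxes have radius [4 ^ j] so that [(4 ^ j) ^ (d / 2)] is the integer
   [(2 ^ d) ^ j].  These powers grow geometrically, hence the sum over [j] of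
   [(2 ^ d) ^ j] times the indicator of the uncoded event is at most twice the
   integrand. *)
Lemma exists_small_uncoded (eps : R) : (1 <= d)%N ->
  (\int[mu]_x ((coding_radius mu phi x) `^ (d%:R / 2)) < +oo)%E -> 0 < eps ->
  exists j, (2 ^ d)%:R ^+ j * fine (mu (uncoded mu phi (4 ^ j))) <= eps.
Proof.
move=> d1 Roo eps0; pose c : R := (2 ^ d)%:R.
set I := (\int[mu]_x _)%E in Roo.
have I0 : (0 <= I)%E by apply: integral_ge0 => x _; exact: poweR_ge0.
have If : I \is a fin_num by rewrite ge0_fin_numE.
have c2 : 2 <= c by rewrite ler_nat -[2%N]expn1 leq_exp2l.
pose E j := uncoded mu phi (4 ^ j).
have mE j : measurable (E j) by apply: measurable_uncoded; rewrite expn_gt0.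
pose e j := fine (mu (E j)).
have eE j : mu (E j) = (e j)%:E by rewrite /e fineK // fin_num_measure.
apply: contrapT => /forallNP small.
(* If all terms exceeded [eps], the first [J] would add up to at least [J * eps], yet twice the
   integral bounds them for every [J]. *)
have big J : J%:R * eps <= 2 * fine I.
  have -> : J%:R * eps = \sum_(j < J) eps by rewrite sumr_const card_ord mulr_natl.
  apply: (@le_trans _ _ (\sum_(j < J) c ^+ j * e j)).
    by apply: ler_sum => j _; have /negP := small j; rewrite -ltNge => /ltW.
  rewrite -ler_pdivrMl // -lee_fin fineK //.
  have -> : (2^-1 * \sum_(j < J) c ^+ j * e j)%:E =
      (\int[mu]_x \sum_(j <- enum 'I_J) ((2^-1 * c ^+ j)%:E * (\1_(E j) x)%:E))%E.
    rewrite ge0_integral_sum //; last 2 first.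
    - move=> j; apply/measurable_funeM/measurable_EFinP; exact: measurable_indic.
    - by move=> j x _; rewrite mule_ge0 ?lee_fin ?mulr_ge0 ?exprn_ge0 ?invr_ge0.
    rewrite big_enum /= mulr_sumr -sumEFin; apply: eq_bigr => j _.
    rewrite ge0_integralZl_EFin //; last 2 first.
    - by apply/measurable_EFinP; exact: measurable_indic.
    - by rewrite mulr_ge0 ?exprn_ge0 ?invr_ge0.
    rewrite mulrA EFinM (integral_indic _ measurableT (mE j)) setIT.
    by congr (_ * _)%E; rewrite -eE.
  apply: ge0_le_integral_nomeas => x.
    apply: sume_ge0 => j _.
    by rewrite mule_ge0 ?lee_fin ?mulr_ge0 ?exprn_ge0 ?invr_ge0.
  have r0 := poweR_ge0 (coding_radius mu phi x) (d%:R / 2).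
  have rE j := @uncoded_radius_power j x.
  move: (_ `^ _)%E r0 rE => [r| |] // r0 rE; last by rewrite leey.
  under eq_bigr do rewrite -EFinM.
  rewrite big_enum /= sumEFin lee_fin.
  under eq_bigr do rewrite -mulrA.
  rewrite -mulr_sumr ler_pdivrMl //.
  under eq_bigr do rewrite indicE.
  apply: (sum_geometric_le (b := fun j => x \in E j)) => // j.
  by rewrite inE => /rE; rewrite lee_fin.
have := archi_boundP (divr_ge0 (mulr_ge0 (ler0n R 2) (fine_ge0 I0)) (ltW eps0)).
rewrite ltr_pdivrMr // ltNge; apply/negP/negPn; exact: big.
Qed.
End Tail.

(** * The variance as a finite sum, and the conclusion *)

Section InfoVariance.
Variables (R : realType) (d : nat) (A : finType) (a0 : A) (p : A -> R).
Variable mu : probability (Omega d a0) R.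
Hypotheses (p_prob : prob_vec p) (mu_iid : iid_measure p mu).

Lemma integral_coord0 (g : A -> R) : (forall a, 0 <= g a) ->
  (\int[mu]_x (g (x 0))%:E = (\sum_a p a * g a)%:E)%E.
Proof.
move=> g0; have mf : fin_measurable (fun x : Omega d a0 => x 0 : A).
  by move=> a; exact: measurable_coord.
rewrite (integral_fin mu mf g0); congr EFin; apply: eq_bigr => a _.
congr (_ * _); rewrite /law.
have := iid_cylinder mu_iid predT (s := fun _ : unit => 0) (fun=> a).
rewrite big_const card_unit /= mulr1 => E.
rewrite (_ : [set x | _] = [set x : Omega d a0 | forall i : unit, predT i -> x 0 = a]).
  by rewrite E //; case=> -[].
by apply/seteqP; split => x /= => [-> //|/(_ tt)]; exact.
Qed.

Lemma variance_info :
  variance mu (fun x : Omega d a0 => info p (x 0)) =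
  (\sum_a p a * (info p a - entropy p) ^+ 2)%:E.
Proof.
have E1 : expectation mu (fun x : Omega d a0 => info p (x 0)) = (entropy p)%:E.
  rewrite unlock integral_coord0 ?sum_info // => a; exact: info_ge0.
rewrite /variance unlock E1 unlock.
rewrite -(@integral_coord0 (fun a => (info p a - entropy p) ^+ 2)) //.
by move=> a; exact: sqr_ge0.
Qed.
End InfoVariance.

(** The cubic decay of [r] is chosen for the worst term, [L ^+ 2 * r], which becomes at most
    [1 / L]. *)
Lemma error_bounds (R : realFieldType) (K L r : R) : 1 <= L -> r <= (L ^+ 3)^-1 ->
  6 * K ^+ 4 / L ^+ 2 + 4 * L * r <= (6 * K ^+ 4 + K ^+ 2 + 8) / L /\
  6 * K ^+ 4 / L ^+ 2 + K ^+ 2 / L + 2 * (L ^+ 2 + 3 * L) * r <=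
    (6 * K ^+ 4 + K ^+ 2 + 8) / L.
Proof.
move=> L1 rL; have L0 : 0 < L by lra.
pose i := L^-1; have i0 : 0 < i by rewrite invr_gt0.
have i1 : i <= 1 by rewrite invf_le1.
have Li : L * i = 1 by rewrite mulfV ?gt_eqF.
have {}rL : r <= i * (i * i) by apply: le_trans rL _; rewrite !exprS expr0 mulr1 !invfM.
have K4 : 0 <= K ^+ 4 by rewrite exprn_even_ge0.
have K2 := sqr_ge0 K.
have i2 : (L ^+ 2)^-1 = i * i by rewrite expr2 invfM.
have ii : i * i <= i by rewrite -[leRHS]mulr1 ler_pM2l.
have kii : K ^+ 4 * (i * i) <= K ^+ 4 * i by rewrite ler_wpM2l.
have k2i : 0 <= K ^+ 2 * i by rewrite mulr_ge0 // ltW.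
have Lr : L * r <= i * i.
  by rewrite -[leRHS]mul1r -Li -mulrA ler_pM2l.
have LLr : L * (L * r) <= i.
  by rewrite -[leRHS]mul1r -Li -mulrA ler_pM2l // (le_trans Lr).
rewrite i2 -/i; move: (K ^+ 4) (K ^+ 2) K4 K2 kii k2i => k4 k2 *.
by split; nra.
Qed.

Unset Implicit Arguments.
Set Strict Implicit.

Theorem theorem1 (R : realType) (d : nat) (A B : finType) (a0 : A) (b0 : B)
  (p : A -> R) (q : B -> R)
  (mu : probability (Omega d a0) R) (nu : probability (Omega d b0) R) :
  (1 <= d)%N ->
  prob_vec p -> prob_vec q ->
  iid_measure p mu -> iid_measure q nu ->
  entropy p = entropy q ->
  (exists phi : Omega d a0 -> Omega d b0,
     [/\ factor_map mu nu phi,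
         {ae mu, forall x, (coding_radius mu phi x < +oo)%E} &
         (\int[mu]_x ((coding_radius mu phi x) `^ (d%:R / 2)) < +oo)%E]) ->
  variance mu (fun x : Omega d a0 => info p (x 0))
  = variance nu (fun y : Omega d b0 => info q (y 0)).
Proof.
move=> d1 p_prob q_prob mu_iid nu_iid entropy_eq [phi [phi_factor _ Roo]].
rewrite !variance_info //; congr EFin.
set s2p := \sum_a _; set s2q := \sum_b _.
have s2p0 : 0 <= s2p.
  by apply: sumr_ge0 => a _; rewrite mulr_ge0 ?sqr_ge0 ?(proj1 p_prob).
have s2q0 : 0 <= s2q.
  by apply: sumr_ge0 => b _; rewrite mulr_ge0 ?sqr_ge0 ?(proj1 q_prob).
pose K := info_scale p q; pose C := 6 * K ^+ 4 + K ^+ 2 + 8.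
have K0 : 0 <= K by rewrite !addr_ge0 ?sumr_ge0.
(* Here [l] is the block size in units of [M] and [k + 1] the clipping level. Both are fixed before
   the window radius [M = 4 ^ j] is chosen. *)
have approx l k : l.+2%:R ^+ d * s2p <= l.+4%:R ^+ d * s2q + l.+4.+4%:R ^+ d * C / k.+1%:R /\
    l%:R ^+ d * s2q <= l.+2%:R ^+ d * s2p + l.+4.+4%:R ^+ d * C / k.+1%:R.
  have L1 : 1 <= k.+1%:R :> R by rewrite ler1n.
  pose S : R := Num.sqrt (l.+4.+4%:R ^+ d).
  have SK0 : 0 <= S * K by rewrite mulr_ge0 ?sqrtr_ge0.
  (* This makes [S * K * eps] at most the inverse cube of the level; the added 1 keeps the
     denominator positive. *)
  pose eps : R := (k.+1%:R ^+ 3)^-1 / (S * K + 1).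
  have eps0 : 0 < eps by rewrite divr_gt0 ?invr_gt0 ?exprn_gt0 ?ltr_wpDl.
  have [j je] := exists_small_uncoded mu_iid d1 Roo eps0.
  have M0 : (0 < 4 ^ j)%N by rewrite expn_gt0.
  have n1 : (1 < l.+4.+4 * 4 ^ j)%N by nia.
  have := torus_variance_le p_prob q_prob mu_iid nu_iid phi_factor n1 entropy_eq
    M0 (erefl _) L1.
  rewrite -/K -/s2p -/s2q; set r := _ * (K * _).
  have rE : r = S * K * ((2 ^ d)%:R ^+ j * fine (mu (uncoded mu phi (4 ^ j)))).
    rewrite /r expnMn natrM sqrtrM ?ler0n // natrX -/S.
    (* The volume [M ^ d] is a perfect square, so [rho] is [S] times the factor [(2 ^ d) ^ j] of the
       tail bound. *)
    have -> : ((4 ^ j) ^ d)%N%:R = ((2 ^ d)%:R ^+ j) ^+ 2 :> R.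
      by rewrite -!natrX -!expnM (_ : 4 = 2 ^ 2)%N // -expnM; congr (2 ^ _)%N%:R; lia.
    by rewrite sqrtr_sqr ger0_norm ?exprn_ge0 //; ring.
  have rL : r <= (k.+1%:R ^+ 3)^-1.
    rewrite rE; apply: le_trans (ler_wpM2l SK0 je) _.
    rewrite /eps mulrCA ler_piMr ?invr_ge0 ?exprn_ge0 //.
    by rewrite ler_pdivrMr ?ltr_wpDl // mul1r lerDl.
  have [e1 e2] := error_bounds K L1 rL.
  have l8 : 0 <= l.+4.+4%:R ^+ d :> R by rewrite exprn_ge0.
  move=> [h1 h2]; rewrite -![_ * C / _]mulrA; split.
    by apply: le_trans h1 _; rewrite lerD2l ler_wpM2l.
  by apply: le_trans h2 _; rewrite lerD2l ler_wpM2l.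
apply/eqP; rewrite eq_le; apply/andP; split.
  (* The clipping level goes to infinity first, at fixed [l], and then [l]. The smaller side is
     [l + 2] here, so the ratio argument starts at 2. *)
  apply: (@le_of_volume_ratio _ d 2) => // -[|[|l]] // _.
  by apply: le_of_archi => k; have [h _] := approx l k; exact: h.
apply: (@le_of_volume_ratio _ d 0) => // l _.
by apply: le_of_archi => k; have [_ h] := approx l k; exact: h.
Qed.
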